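(* For every pair of integers $r,s\ge 1$, the division set $F_s/E_r$ is compact, perfect, nowhere dense in $\mathbb{R}$, and of positive Lebesgue measure. Moreover, $$\dim_{\mathrm H}E_r\longrightarrow 1\ (r\to\infty),\qquad \dim_{\mathrm H}F_s\longrightarrow 1\ (s\to\infty).$$ For all sufficiently large $r$ and $s$, each of the self-products $E_rE_r$ and $F_sF_s$ contains a nondegenerate interval. In addition, $E_6E_6$ and $F_5F_5$ contain nondegenerate intervals.
   Context: For an integer $N\ge 2$ and a digit set $D\subset\{0,\ldots,N-1\}$, write $K_{N,D}=\{\sum_{j=1}^{\infty}d_jN^{-j}:d_j\in D\}$. For integers $r,s\ge 1$ set $$A_r=25^r,\qquad B_s=49^s,\qquad q_r=\frac{A_r-1}{24},\qquad t_s=\frac{B_s-1}{24},$$ and $$E_r=K_{A_r,\{13q_r,\,13q_r+1,\ldots,24q_r\}},\qquad F_s=K_{B_s,\{t_s,\,t_s+1,\ldots,12t_s\}}$$ (blocks of consecutive integer digits). For sets $X,Y\subset(0,\infty)$, $Y/X=\{y/x:x\in X,\ y\in Y\}$ and $XY=\{xy:x\in X,\ y\in Y\}$. $\dim_{\mathrm H}$ is Hausdorff dimension. *)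

(* Defs.v *)
From HB Require Import structures.
From mathcomp Require Import all_boot all_order all_algebra.
From mathcomp Require Import all_classical all_reals all_analysis.

Set Implicit Arguments.
Unset Strict Implicit.
Unset Printing Implicit Defensive.

Import Order.TTheory GRing.Theory Num.Theory numFieldNormedType.Exports.

Local Open Scope classical_set_scope.
Local Open Scope ring_scope.

(* The series starts at N^-1: d is indexed from 0, so d j is the digit of
   N^-(j+1). *)
Definition digit_set (R : realType) (N : nat) (D : set nat) : set R :=
  [set x | exists2 d : nat -> nat, (forall j, D (d j)) &
     series (fun j => (d j)%:R / N%:R ^+ j.+1 : R) @ \oo --> x].
Arguments digit_set R N D : clear implicits.

(* 25 and 49 are 1 modulo 24, so both divisions by 24 are exact. *)
Definition baseA (r : nat) : nat := (25 ^ r)%N.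
Definition baseB (s : nat) : nat := (49 ^ s)%N.
Definition stepq (r : nat) : nat := ((baseA r - 1) %/ 24)%N.
Definition stept (s : nat) : nat := ((baseB s - 1) %/ 24)%N.

Definition setE (R : realType) (r : nat) : set R :=
  digit_set R (baseA r) [set d | (13 * stepq r <= d <= 24 * stepq r)%N].
Arguments setE R r : clear implicits.

Definition setF (R : realType) (s : nat) : set R :=
  digit_set R (baseB s) [set d | (stept s <= d <= 12 * stept s)%N].
Arguments setF R s : clear implicits.

Definition division_set (R : realType) (Y X : set R) : set R :=
  [set y / x | y in Y & x in X].

Definition product_set (R : realType) (X Y : set R) : set R :=
  [set x * y | x in X & y in Y].

Definition nowhere_dense (T : topologicalType) (A : set T) : Prop :=
  interior (closure A) = set0.

Definition contains_interval (R : realType) (A : set R) : Prop :=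
  exists a b : R, a < b /\ `[a, b] `<=` A.

Section hausdorff_dimension.
Context (R : realType).
Implicit Types (A U : set R) (s delta : R).
Local Open Scope ereal_scope.

(* 0 is added because ereal_sup set0 = -oo. *)
Definition diam U : \bar R :=
  ereal_sup (0 |` [set `|x - y|%:E | x in U & y in U]).

(* The empty set has weight 0 even for s = 0, while a singleton then has
   weight 0 `^ 0 = 1. *)
Definition diam_pow s U : \bar R :=
  if U == set0 then 0 else diam U `^ s.

Definition hausdorff_premeasure s delta A : \bar R :=
  ereal_inf [set \sum_(0 <= i <oo) diam_pow s (U i) |
    U in [set U : nat -> set R |
           (forall i, diam (U i) <= delta%:E) /\ A `<=` \bigcup_i U i]].

(* The premeasure increases as delta decreases, so its limit at 0+ is a
   supremum. *)
Definition hausdorff_measure s A : \bar R :=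
  ereal_sup [set hausdorff_premeasure s delta A | delta in [set e : R | (0 < e)%R]].

Definition hausdorff_dim A : \bar R :=
  ereal_inf [set s%:E | s in [set s : R | (0 <= s)%R /\ hausdorff_measure s A = 0]].

End hausdorff_dimension.

(* Main.v *)
(* Both families are blocks K p q of consecutive digits p q, ..., (p + 11) q in
   base 24 q + 1: E_r is K 13 q_r and F_s is K 1 t_s, and K p q has convex hull
   [p / 24, (p + 11) / 24].

   Nowhere density: if F_s / E_r had interior it would contain some A^i / B^j,
   since these quotients are dense; but A^i E_r lies in Z + [13/24, 1] and B^j F_s
   in Z + [1/24, 1/2].

   Products: if I lies below J with 13 sup I <= 11 inf J, then the product of two
   cylinders I, J of equal length is exactly the union of the products of their
   subcylinders, so a product of two suitable first-level cylinders is an interval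
   in K K.

   Dimension: reading the digits of a point in base 11 q + 1 maps K p q onto
   [0, 1] and is Hoelder of exponent ln (11 q + 1) / ln (24 q + 1).

   Positive measure: it suffices to treat F_1 / E_1.  Let mu and nu be the uniform
   measures on the level-l points of E_1 and F_1.  By Cauchy-Schwarz, F_1 / E_1
   meets a positive proportion of the cells of length 1/K as soon as
   sum_(k < K) |mu^(k)|^2 |nu^(k)|^2 is bounded, where mu^(k), nu^(k) are the
   exponential sums with phases k (ln x) / 2.  The large sieve bounds the mean
   square of nu^; linearizing ln x around prefixes of length 13 n, for k of size
   25^(23 n), reduces a pointwise bound on mu^ to the large sieve again.  The block
   k ~ 25^(23 n) then contributes at most a constant times 2^(-n), because
   49^19 <= 25^23 and 2 * 25^36 <= 12^23 * 23^19; this is where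
   dim E_1 + dim F_1 > 3/2 enters. *)

Require Import Defs.
From HB Require Import structures.
From mathcomp Require Import all_boot all_order all_algebra.
From mathcomp Require Import all_classical all_reals all_analysis.
From mathcomp Require Import ring lra zify.
Import Order.TTheory GRing.Theory Num.Theory numFieldNormedType.Exports.
Local Open Scope classical_set_scope.
Local Open Scope ring_scope.
Set Implicit Arguments.
Unset Strict Implicit.
Unset Printing Implicit Defensive.

(** * Block digit sets *)

Definition block_set (R : realType) (p q : nat) : set R :=
  digit_set R (24 * q + 1) [set d | (p * q <= d <= (p + 11) * q)%N].

Arguments block_set : clear implicits.

Section block_sets.
Context (R : realType).
Implicit Types (x y : R) (d : nat -> nat) (N p q : nat).

Let expansion N d x : Prop :=
  series (fun j => (d j)%:R / N%:R ^+ j.+1 : R) @ \oo --> x.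

(** The partial sums are exactly [y 0 - y n / N ^ n], so boundedness of the orbit [y] forces
    convergence. *)
Lemma expansion_tail N d (y : nat -> R) : (1 < N)%N ->
  (forall n, 0 <= y n <= 1) -> (forall n, y n.+1 = N%:R * y n - (d n)%:R) ->
  expansion N d (y 0%N).
Proof.
move=> N1 y01 yS; have N0 : N%:R != 0 :> R by rewrite pnatr_eq0; lia.
have serE n : series (fun j => (d j)%:R / N%:R ^+ j.+1 : R) n
    = y 0%N - y n / N%:R ^+ n.
  elim: n => [|n IH]; first by rewrite /series /= big_geq// expr0 divr1 subrr.
  rewrite seriesSr IH yS exprS; field.
  by rewrite N0 expf_neq0.
have NV1 : `|N%:R^-1 : R| < 1.
  by rewrite ger0_norm ?invr_ge0// invf_lt1 ?ltr1n ?ltr0n//; lia.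
rewrite /expansion; apply/cvgrPdist_le => e e0.
have /cvgrPdist_le /(_ _ e0) := @cvg_expr R _ NV1.
apply: filterS => n; rewrite serE subKr sub0r normrN => H.
have /andP[yn0 yn1] := y01 n.
have Nn : 0 <= (N%:R : R)^-1 ^+ n by rewrite exprn_ge0 ?invr_ge0.
rewrite ger0_norm; last by rewrite -exprVn mulr_ge0.
by apply: le_trans H; rewrite ger0_norm// -exprVn ler_piMl.
Qed.

Lemma expansion_shift N d x : (1 < N)%N -> expansion N d x ->
  expansion N (d \o S) (N%:R * x - (d 0%N)%:R).
Proof.
move=> N1 dx; have N0 : N%:R != 0 :> R by rewrite pnatr_eq0; lia.
rewrite /expansion.
have -> : series (fun j => ((d \o S) j)%:R / N%:R ^+ j.+1 : R) =
    fun n => N%:R * series (fun j => (d j)%:R / N%:R ^+ j.+1 : R) n.+1 - (d 0%N)%:R.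
  apply/funext => n; elim: n => [|n IH].
    rewrite /series /= big_geq// big_nat1 expr1.
    by rewrite mulrC divfK// subrr.
  rewrite seriesSr IH [series _ n.+2]seriesSr /= !exprS; field.
  by rewrite N0 expf_neq0.
apply: cvgB; last exact: cvg_cst.
apply: cvgM; first exact: cvg_cst.
by move: dx; rewrite /expansion -cvg_shiftS.
Qed.

Lemma expansion_bound N d x (l h : nat) : (1 < N)%N ->
  (forall j, (l <= d j <= h)%N) -> expansion N d x ->
  l%:R / (N%:R - 1) <= x <= h%:R / (N%:R - 1).
Proof.
move=> N1 dlh dx.
have N0 : N%:R != 0 :> R by rewrite pnatr_eq0; lia.
have N1' : (N%:R : R) - 1 != 0 by rewrite subr_eq0 pnatr_eq1; lia.
have N1p : 0 < (N%:R : R) - 1 by rewrite subr_gt0 ltr1n.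
have NV1 : `|N%:R^-1 : R| < 1.
  by rewrite ger0_norm ?invr_ge0// invf_lt1 ?ltr1n ?ltr0n//; lia.
have Nn n : 0 <= (N%:R : R)^-1 ^+ n by rewrite exprn_ge0 ?invr_ge0.
have lim (c : R) : (fun n => c / (N%:R - 1) * (1 - N%:R^-1 ^+ n) : R) @ \oo --> c / (N%:R - 1).
  rewrite -[X in _ --> X]mulr1; apply: cvgM; first exact: cvg_cst.
  rewrite -[X in _ --> X]subr0; apply: cvgB; first exact: cvg_cst.
  exact: cvg_expr.
have stp (c : R) n : c / (N%:R - 1) * (1 - N%:R^-1 ^+ n.+1) =
   c / (N%:R - 1) * (1 - N%:R^-1 ^+ n) + c / N%:R ^+ n.+1 :> R.
  rewrite !exprVn exprS; field.
  by rewrite N0 N1' expf_neq0.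
apply/andP; split.
- apply: (ler_cvg_to (lim _) dx); apply: nearW; elim => [|n IH].
    by rewrite expr0 subrr mulr0 /series /= big_geq.
  rewrite stp seriesSr lerD//.
  by rewrite ler_wpM2r ?invr_ge0 ?exprn_ge0// ler_nat; case/andP: (dlh n).
- apply: (ler_cvg_to dx (lim _)); apply: nearW; elim => [|n IH].
    by rewrite expr0 subrr mulr0 /series /= big_geq.
  rewrite stp seriesSr lerD//.
  by rewrite ler_wpM2r ?invr_ge0 ?exprn_ge0// ler_nat; case/andP: (dlh n).
Qed.

(** A coinduction principle: choice picks an admissible digit at each point of [P], and the
    resulting orbit stays in [0, 1], so [expansion_tail] yields the expansion. *)
Lemma block_set_coind p q (P : set R) : (0 < q)%N ->
  (forall x, P x -> 0 <= x <= 1 /\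
     exists2 k : nat, (p * q <= k <= (p + 11) * q)%N & P ((24 * q + 1)%:R * x - k%:R)) ->
  P `<=` block_set R p q.
Proof.
move=> q0 Pstep x Px.
have /choice[D DP] : forall z : {z | P z}, exists k : nat,
    (p * q <= k <= (p + 11) * q)%N /\ P ((24 * q + 1)%:R * sval z - k%:R).
  by move=> [z Pz]; have [_ [k ? ?]] := Pstep _ Pz; exists k.
pose F (z : {z | P z}) : {z | P z} := exist P _ (DP z).2.
pose y n := iter n F (exist P x Px).
exists (fun n => D (y n)).
  by move=> j; exact: (DP (y j)).1.
apply: (@expansion_tail _ _ (fun n => sval (y n))) => //; first by lia.
by move=> n; case: (y n) => z Pz; exact: (Pstep z Pz).1.
Qed.

Lemma block_set_step p q x : (0 < q)%N -> block_set R p q x ->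
  exists2 k : nat, (p * q <= k <= (p + 11) * q)%N &
    block_set R p q ((24 * q + 1)%:R * x - k%:R).
Proof.
move=> q0 [d Dd dx]; exists (d 0%N); first exact: (Dd 0%N).
exists (d \o S); first by move=> j; exact: Dd.
by apply: expansion_shift => //; lia.
Qed.

Lemma block_set_bound p q x : (0 < q)%N -> block_set R p q x ->
  p%:R / 24 <= x <= (p + 11)%:R / 24.
Proof.
move=> q0 [d Dd dx].
have q0' : q%:R != 0 :> R by rewrite pnatr_eq0; lia.
have /(_ (p * q)%N ((p + 11) * q)%N) := @expansion_bound (24 * q + 1) d x.
have e (m : nat) : (m * q)%:R / ((24 * q + 1)%:R - 1) = m%:R / 24 :> R.
  by rewrite natrD addrK !natrM; field.
rewrite !e.
by apply => //; lia.
Qed.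

Lemma block_set_cons p q x (k : nat) : (0 < q)%N -> (p <= 13)%N ->
  (p * q <= k <= (p + 11) * q)%N -> block_set R p q x ->
  block_set R p q ((k%:R + x) / (24 * q + 1)%:R).
Proof.
move=> q0 p13 kpq Kx; have Nn0 : (24 * q + 1)%:R != 0 :> R by rewrite pnatr_eq0; lia.
have Nn1 : 0 < (24 * q + 1)%:R :> R by rewrite ltr0n; lia.
apply: (@block_set_coind p q [set z | block_set R p q z \/ z = (k%:R + x) / (24 * q + 1)%:R]) => //; last by right.
have hull z : block_set R p q z -> 0 <= z <= 1.
  move=> /(block_set_bound q0) /andP[pz zp]; apply/andP; split.
    by apply: le_trans pz; rewrite divr_ge0.
  by apply: (le_trans zp); rewrite ler_pdivrMr// mul1r ler_nat; lia.
move=> z /= [Kz|->].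
  split; first exact: hull.
  by have [m ? ?] := block_set_step q0 Kz; exists m => //; left.
have /andP[x0 x1] := hull _ Kx; split.
  apply/andP; split; first by rewrite divr_ge0 ?addr_ge0.
  rewrite ler_pdivrMr// mul1r natrD lerD// ler_nat.
  by case/andP: kpq => _ /leq_trans; apply; rewrite leq_mul2r; lia.
exists k => //; left; rewrite mulrC divfK//.
by rewrite addrC addKr.
Qed.

End block_sets.

(** * Topology of block sets and division sets *)

Section block_set_topology.
Context (R : realType).
Implicit Types (x y e eps : R) (p q n k m : nat).

(** The constant digit [m * q] in base [24 * q + 1] sums to [m / 24]. Such points serve as explicit
    tails. *)
Lemma block_set_const p q m : (0 < q)%N -> (p <= 13)%N ->
  (p <= m <= p + 11)%N -> block_set R p q (m%:R / 24).
Proof.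
move=> q0 p13 /andP[pm mp].
apply: (@block_set_coind R p q [set m%:R / 24]) => // x ->; split.
  by rewrite divr_ge0//= ler_pdivrMr// mul1r ler_nat; lia.
exists (m * q)%N; first by rewrite !leq_mul2r pm mp !orbT.
by rewrite /= natrD !natrM; field.
Qed.

(** Here [k] encodes the first [n] digits and [e] is the tail; the last clause lets any other tail
    be spliced in. *)
Lemma block_set_prefix p q x n : (0 < q)%N -> (p <= 13)%N -> block_set R p q x ->
  exists k e, [/\ block_set R p q e, x = (k%:R + e) / (24 * q + 1)%:R ^+ n &
    forall e', block_set R p q e' ->
      block_set R p q ((k%:R + e') / (24 * q + 1)%:R ^+ n)].
Proof.
move=> q0 p13; set N : R := (24 * q + 1)%:R.
have N0 : N != 0 by rewrite pnatr_eq0; lia.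
elim: n x => [|n IH] x Kx.
  exists 0%N, x; rewrite add0r expr0 divr1; split=> // e.
  by rewrite add0r divr1.
have [d dpq /IH[k [e [Ke xE ext]]]] := block_set_step q0 Kx.
exists (d * (24 * q + 1) ^ n + k)%N, e.
have cons e' : ((d * (24 * q + 1) ^ n + k)%:R + e') / N ^+ n.+1 =
    (d%:R + (k%:R + e') / N ^+ n) / N.
  by rewrite natrD natrM natrX -/N exprS; clearbody N; field; rewrite N0 expf_neq0.
split => //.
  by rewrite cons -xE -/N addrC subrK mulrC mulKf.
by move=> e' Ke'; rewrite cons; apply: block_set_cons => //; exact: ext.
Qed.

(** Scaled by the base, the hulls of the first-level cylinders have length 11/24 and left ends at
    least 1 apart, so different digits leave a gap of at least 13/24. *)
Lemma block_set_digit_inj p q x y k m : (0 < q)%N ->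
  block_set R p q ((24 * q + 1)%:R * x - k%:R) ->
  block_set R p q ((24 * q + 1)%:R * y - m%:R) ->
  `|x - y| < 13 / 24 / (24 * q + 1)%:R -> k = m.
Proof.
move=> q0; set N : R := (24 * q + 1)%:R; have N0 : 0 < N by rewrite ltr0n; lia.
move=> /(block_set_bound q0) /andP[+ +] /(block_set_bound q0) /andP[+ +].
have xyN : (`|x - y| < 13 / 24 / N) = (`|N * x - N * y| < 13 / 24).
  by rewrite ltr_pdivlMr// -mulrBr normrM (gtr0_norm N0) mulrC.
rewrite xyN ltr_norml => h1 h2 h3 h4 /andP[h5 h6].
have ppp : (p + 11)%:R = p%:R + 11 :> R by rewrite natrD.
rewrite ppp in h2 h4.
have [km|mk|//] := ltngtP k m.
- have : (k%:R : R) + 1 <= m%:R by rewrite natr1 ler_nat.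
  by move=> ?; exfalso; lra.
- have : (m%:R : R) + 1 <= k%:R by rewrite natr1 ler_nat.
  by move=> ?; exfalso; lra.
Qed.

Lemma block_set_closed p q : (0 < q)%N -> (p <= 13)%N -> closed (block_set R p q).
Proof.
move=> q0 p13; set N : R := (24 * q + 1)%:R; have N0 : 0 < N by rewrite ltr0n; lia.
(* [P] is the closure; being stable under removal of a digit, it falls under coinduction. *)
pose P : set R := [set x | forall eps : R, 0 < eps ->
  exists2 y, block_set R p q y & `|x - y| < eps].
suff PK : P `<=` block_set R p q.
  move=> x clx; apply: PK => eps eps0.
  have [y [Ky xy]] := clx _ (nbhsx_ballx x eps eps0).
  by exists y.
apply: block_set_coind => // x Px.
have hull (eps : R) : 0 < eps -> - eps <= x <= 1 + eps.
  move=> /Px[y /(block_set_bound q0) /andP[y0 y1]].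
  have : (p + 11)%:R / 24 <= 1 :> R by rewrite ler_pdivrMr// mul1r ler_nat; lia.
  have : 0 <= p%:R / 24 :> R by rewrite divr_ge0.
  by rewrite ltr_norml => + + /andP[]; lra.
split.
  apply/andP; split.
  - by rewrite -oppr_le0; apply/ler_addgt0Pr => z /hull /andP[]; lra.
  - by apply/ler_addgt0Pr => z /hull /andP[].
(* One approximant closer than [13 / 48 / N] fixes the digit: any other that close is within
   [13 / 24 / N] of it and shares it. *)
have [y0 Ky0 xy0] := Px (13 / 48 / N) ltac:(by rewrite !divr_gt0).
have [k kpq Kk] := block_set_step q0 Ky0.
exists k => // eps eps0.
have [|y Ky xy] := Px (Num.min (13 / 48 / N) (eps / N)).
  by rewrite lt_min !divr_gt0.
move: xy; rewrite lt_min => /andP[xy1 xy2].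
have [m mpq Km] := block_set_step q0 Ky.
have km : k = m.
  apply: (block_set_digit_inj q0 Kk Km).
  have -> : y0 - y = (x - y) - (x - y0) by ring.
  apply: (le_lt_trans (ler_normB _ _)).
  have -> : 13 / 24 / N = 13 / 48 / N + 13 / 48 / N by field; rewrite gt_eqF.
  exact: ltrD.
exists (N * y - m%:R) => //; rewrite km.
have -> : N * x - m%:R - (N * y - m%:R) = (x - y) * N by ring.
by rewrite normrM (gtr0_norm N0) -ltr_pdivlMr.
Qed.

Lemma block_set_compact p q : (0 < q)%N -> (p <= 13)%N -> compact (block_set R p q).
Proof.
move=> q0 p13; apply: (subclosed_compact (block_set_closed q0 p13)
  (@segment_compact _ (p%:R / 24) ((p + 11)%:R / 24))).
by move=> x /(block_set_bound q0); rewrite /= in_itv.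
Qed.

Lemma block_set_dense_in_itself p q x eps : (0 < q)%N -> (p <= 13)%N ->
  block_set R p q x -> 0 < eps ->
  exists y, [/\ y != x, block_set R p q y & `|y - x| < eps].
Proof.
move=> q0 p13 Kx eps0; set N : R := (24 * q + 1)%:R.
have N1 : 1 < N by rewrite ltr1n; lia.
have N0 : 0 < N by apply: lt_trans N1.
have [n Nn] : exists n, N ^- n < eps.
  have NV1 : `|N^-1| < 1 by rewrite gtr0_norm ?invr_gt0// invf_lt1.
  have /cvgrPdist_lt /(_ _ eps0)[n _ /(_ n (leqnn n))] := @cvg_expr R _ NV1.
  rewrite sub0r normrN ger0_norm; last by rewrite exprn_ge0// invr_ge0 ltW.
  by rewrite exprVn; exists n.
have [k [e [Ke -> ext]]] := block_set_prefix n q0 p13 Kx.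
(* Of the two tails [p / 24] and [(p + 1) / 24], at least one differs from [e]. *)
have [m [mpq me]] : exists m, (p <= m <= p + 11)%N /\ m%:R / 24 != e.
  have [->|/eqP pe] := pselect (e = p%:R / 24); last first.
    by exists p; rewrite leqnn leq_addr eq_sym.
  exists p.+1; rewrite leqnSn; split; first by lia.
  by apply/eqP => /mulIf -/(_ ltac:(by rewrite invr_neq0)) /eqP; rewrite eqr_nat; lia.
have Km := block_set_const q0 p13 mpq.
exists ((k%:R + m%:R / 24) / N ^+ n); split; last first.
- rewrite -mulrBl opprD addrACA subrr add0r normrM.
  rewrite [X in _ * X]ger0_norm ?invr_ge0 ?exprn_ge0 ?ltW//.
  apply: le_lt_trans Nn; rewrite ler_piMl ?invr_ge0 ?exprn_ge0 ?ltW//.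
  have := block_set_bound q0 Km; have := block_set_bound q0 Ke.
  have ppp : (p + 11)%:R = p%:R + 11 :> R by rewrite natrD.
  by rewrite ppp ltr_norml => /andP[? ?] /andP[? ?]; apply/andP; split; lra.
- exact: ext.
- apply: contra me => /eqP H; apply/eqP.
  by move: H; rewrite !mulrDl => /addrI /(mulIf _); apply; rewrite invr_neq0// expf_neq0 ?gt_eqF.
Qed.

Lemma division_set_compact (X Y : set R) : X `<=` [set x | 0 < x] ->
  compact X -> compact Y -> compact (division_set Y X).
Proof.
move=> X0 cX cY; rewrite /division_set image2E.
apply: continuous_compact; last exact: compact_setX.
apply: continuous_in_subspaceT => -[y x]; rewrite inE /= => -[/= Yy Xx].
have -> : uncurry (fun a b : R => a / b) = (fun z : R * R => z.1 / z.2).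
  by apply/funext => -[].
apply: cvgM; first exact: cvg_fst.
apply: cvgV; last exact: cvg_snd.
by rewrite gt_eqF//; exact: X0.
Qed.

(** Perturbing the numerator alone produces nearby quotients. *)
Lemma division_set_perfect (X Y : set R) : X `<=` [set x | 0 < x] ->
  compact X -> compact Y ->
  (forall y (eps : R), Y y -> 0 < eps -> exists z, [/\ z != y, Y z & `|z - y| < eps]) ->
  perfect_set (division_set Y X).
Proof.
move=> X0 cX cY Yperf.
have cl : closed (division_set Y X).
  by apply: compact_closed; [exact: Rhausdorff|exact: division_set_compact].
split=> //; apply/seteqP; split => [v|_ [y Yy [x Xx <-]] U].
  by move=> lv; apply: cl => U /lv[w [_ ? ?]]; exists w.
move=> /nbhs_ballP[eps /= eps0 epsU].
have x0 := X0 _ Xx; rewrite /= in x0.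
have [z [zy Yz zye]] := Yperf y (eps * x) Yy (mulr_gt0 eps0 x0).
exists (z / x); split.
- by apply: contra zy => /eqP/(mulIf _) ->//; rewrite invr_neq0 ?gt_eqF.
- by exists z => //; exists x.
- apply: epsU; rewrite /ball/= -mulrBl normrM normfV (gtr0_norm x0).
  by rewrite ltr_pdivrMr// distrC.
Qed.

End block_set_topology.

(** * Products of block sets *)

Section tails.
Context (R : realType).
Implicit Types (d : nat -> nat) (p q : nat).

(** Gives all tails of a digit sequence at once, so that digits chosen greedily can be followed
    level by level. Convergence is monotone, by the bound [1 - N ^- n] on the partial sums. *)
Lemma block_set_tails p q d : (0 < q)%N -> (p <= 13)%N ->
  (forall j, (p * q <= d j <= (p + 11) * q)%N) ->
  exists e : nat -> R, (forall n, block_set R p q (e n)) /\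
    (forall n, e n.+1 = (24 * q + 1)%:R * e n - (d n)%:R).
Proof.
move=> q0 p13 dD; set N : R := (24 * q + 1)%:R.
have N1 : 1 < N by rewrite ltr1n; lia.
have N0 : 0 < N by apply: lt_trans N1.
pose u := series (fun j => (d j)%:R / N ^+ j.+1 : R).
have ule n : u n <= 1 - N ^- n.
  elim: n => [|n IH]; first by rewrite /u /series /= big_geq// expr0 invr1 subrr.
  rewrite /u seriesSr; apply: (le_trans (lerD IH (lexx _))).
  have -> : 1 - N ^- n.+1 = 1 - N ^- n + (N - 1) / N ^+ n.+1.
    by rewrite exprS; clearbody N; field; rewrite !gt_eqF ?exprn_gt0.
  rewrite lerD2l ler_pM2r ?invr_gt0 ?exprn_gt0//.
  rewrite lerBrDr natr1 ler_nat; case/andP: (dD n) => _ /leq_ltn_trans; apply.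
  by nia.
have [x ux] : exists x : R, u @ \oo --> x.
  exists (limn u); apply: nondecreasing_is_cvgn.
    apply/nondecreasing_seqP => n.
    by rewrite /u seriesSr lerDl divr_ge0// exprn_ge0// ltW.
  exists 1 => _ [n _ <-]; apply: (le_trans (ule n)).
  by rewrite gerBl invr_ge0 exprn_ge0// ltW.
pose e := fix e n := if n is m.+1 then N * e m - (d m)%:R else x.
have eK n : series (fun j => (d (n + j)%N)%:R / N ^+ j.+1 : R) @ \oo --> e n.
  elim: n => [//|n IH] /=.
  have := expansion_shift _ IH; rewrite addn0; under eq_fun do rewrite /= addnS -addSn.
  by apply; lia.
exists e; split=> // n; exists (fun j => d (n + j)%N) => //.
by move=> j; exact: dD.
Qed.

End tails.

Section products.
Context (R : realType).
Implicit Types (p q : nat).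

Lemma last_le_index (f : nat -> R) (t : R) n : f 0%N <= t ->
  exists k, [/\ (k <= n)%N, f k <= t & k = n \/ t < f k.+1].
Proof.
move=> f0; elim: n => [|n [k [kn fk [kE|tk]]]]; first by exists 0%N; split=> //; left.
- subst k; have [h|h] := leP (f n.+1) t; first by exists n.+1; split=> //; left.
  by exists n; split=> //; right.
- by exists k; split=> //; [exact: leqW|right].
Qed.

(* [h] is the distance between the left ends of consecutive subintervals, each
   of length [11/24 * h]. *)
Lemma product_cover_step q (i j h t : R) : (0 < q)%N -> 0 < i -> 0 < h ->
  let L := h * (11 * q%:R + 11 / 24) in
  13 * (i + L) <= 11 * j -> j + L <= 11 * q%:R * i ->
  i * j <= t <= (i + L) * (j + L) ->
  exists k m, [/\ (k <= 11 * q)%N, (m <= 11 * q)%N &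
   (i + h * k%:R) * (j + h * m%:R) <= t <=
   (i + h * k%:R + 11 / 24 * h) * (j + h * m%:R + 11 / 24 * h)].
Proof.
move=> q0 i0 h0 L ij ji /andP[t1 t2].
have q1 : 1 <= q%:R :> R by rewrite ler1n.
have L0 : 11 * q%:R * h <= L by rewrite /L; nra.
have j0 : 0 < j by have : 0 < L; nra.
have [|k [kq kt kn]] := @last_le_index (fun k => (i + h * k%:R) * j) t (11 * q).
  by rewrite mulr0 addr0.
set i' := i + h * k%:R in kt *.
have ii' : i <= i' by rewrite /i' lerDl mulr_ge0// ltW.
have i'L : i' + 11 / 24 * h <= i + L.
  have : k%:R <= 11 * q%:R :> R by rewrite -natrM ler_nat.
  by rewrite /i' /L => ?; nra.
(* Strips for consecutive [k] overlap: the missing [13 / 24 * h * j] is covered by the gain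
   [i' * L], because [j + L <= 11 * q * i]. *)
have tk : t <= (i' + 11 / 24 * h) * (j + L).
  case: kn => [kE|].
    apply: (le_trans t2); rewrite le_eqVlt; apply/orP; left; apply/eqP.
    by rewrite /i' /L kE natrM; ring.
  rewrite -natr1 mulrDr mulr1 addrA -/i' => /ltW/le_trans; apply.
  have : i * (11 * q%:R * h) <= i' * L by apply: ler_pM => //; nra.
  by nra.
(* Likewise inside the strip: the gap [13 / 24 * h * i'] is covered by [11 / 24 * h * j'], thanks to
   [13 * (i + L) <= 11 * j]. *)
have [|m [mq mt mn]] := @last_le_index (fun m => i' * (j + h * m%:R)) t (11 * q).
  by rewrite mulr0 addr0.
exists k, m; split=> //; rewrite mt /= -/i'; case: mn => [mE|].
  apply: (le_trans tk); rewrite le_eqVlt; apply/orP; left; apply/eqP.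
  by rewrite /L mE natrM; ring.
rewrite -natr1 [h * (_ + 1)]mulrDr mulr1 addrA => /ltW/le_trans; apply.
have : 0 <= h * m%:R by rewrite mulr_ge0// ltW.
set j' := j + h * m%:R => hm; have jj' : j <= j' by rewrite lerDl.
by nra.
Qed.

(** Iterates [product_cover_step]: its hypotheses pass to the chosen subcylinders, so [t] stays in a
    nested sequence of products whose sides shrink to 0. *)
Lemma product_cover p q (i j g t : R) : (0 < q)%N -> (p <= 13)%N -> 0 < i -> 0 < g ->
  13 * (i + 11 / 24 * g) <= 11 * j -> j + 11 / 24 * g <= 11 * q%:R * i ->
  i * j <= t <= (i + 11 / 24 * g) * (j + 11 / 24 * g) ->
  exists e f, [/\ block_set R p q e, block_set R p q f &
    t = (i + g * (e - p%:R / 24)) * (j + g * (f - p%:R / 24))].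
Proof.
move=> q0 p13 i0 g0 ij ji tij; set N : R := (24 * q + 1)%:R.
have NE : N = 24 * q%:R + 1 by rewrite /N natrD natrM.
have N1 : 1 < N by rewrite ltr1n; lia.
have N0 : 0 < N by apply: lt_trans N1.
have q1 : 1 <= q%:R :> R by rewrite ler1n.
pose G n := g / N ^+ n; have G0 n : 0 < G n by rewrite divr_gt0 ?exprn_gt0.
have GS n : G n = G n.+1 * N.
  by rewrite /G exprS invfM mulrA mulrAC mulfVK ?gt_eqF// .
(* [s] holds the left ends of the current two cylinders, both of length [11 / 24 * G n]. *)
pose Inv n (s : R * R) := [/\ 0 < s.1, 13 * (s.1 + 11 / 24 * G n) <= 11 * s.2,
  s.2 + 11 / 24 * G n <= 11 * q%:R * s.1 &
  s.1 * s.2 <= t <= (s.1 + 11 / 24 * G n) * (s.2 + 11 / 24 * G n)].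
pose next n (s : R * R) (c : nat * nat) := (s.1 + G n.+1 * c.1%:R, s.2 + G n.+1 * c.2%:R).
have /choice[c cP] : forall z : nat * (R * R), exists c : nat * nat,
    Inv z.1 z.2 -> [/\ (c.1 <= 11 * q)%N, (c.2 <= 11 * q)%N & Inv z.1.+1 (next z.1 z.2 c)].
  move=> [n [a b]] /=; have [|nInv] := pselect (Inv n (a, b)); last by exists (0%N, 0%N).
  rewrite /Inv /= => -[a0 ab ba tab].
  have LE : 11 / 24 * G n = G n.+1 * (11 * q%:R + 11 / 24) by rewrite GS NE; field.
  have tab' := tab; rewrite !LE in ab ba tab'.
  have [k [m [kq mq tkm]]] := product_cover_step q0 a0 (G0 n.+1) ab ba tab'.
  exists (k, m) => _; split=> //=.
  have kq' : k%:R <= 11 * q%:R :> R by rewrite -natrM ler_nat.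
  have mq' : m%:R <= 11 * q%:R :> R by rewrite -natrM ler_nat.
  have Gn := G0 n.+1; set H := G n.+1 in ab ba tkm Gn *.
  have k0 : 0 <= k%:R :> R by []; have m0 : 0 <= m%:R :> R by [].
  have hk : 0 <= H * k%:R by rewrite mulr_ge0// ltW.
  have hm : 0 <= H * m%:R by rewrite mulr_ge0// ltW.
  have hkq : H * k%:R <= H * (11 * q%:R) by rewrite ler_pM2l.
  have hmq : H * m%:R <= H * (11 * q%:R) by rewrite ler_pM2l.
  split=> //=; first by lra.
  - by lra.
  - by have := mulr_ge0 (ler0n R q) hk; lra.
pose s := fix s n := if n is m.+1 then next m (s m) (c (m, s m)) else (i, j).
have sInv n : Inv n (s n).
  elim: n => [|n IH]; first by rewrite /Inv /G expr0 divr1.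
  by have [_ _] := cP (n, s n) IH.
have cle n : ((c (n, s n)).1 <= 11 * q)%N /\ ((c (n, s n)).2 <= 11 * q)%N.
  by have [] := cP (n, s n) (sInv n).
have [|e [eK eS]] := @block_set_tails R p q (fun n => p * q + (c (n, s n)).1)%N q0 p13.
  by move=> n; have := (cle n).1; rewrite mulnDl leq_addr leq_add2l.
have [|f [fK fS]] := @block_set_tails R p q (fun n => p * q + (c (n, s n)).2)%N q0 p13.
  by move=> n; have := (cle n).2; rewrite mulnDl leq_addr leq_add2l.
exists (e 0%N), (f 0%N); split=> //.
have G00 : G 0%N = g by rewrite /G expr0 divr1.
have xE n : i + g * (e 0%N - p%:R / 24) = (s n).1 + G n * (e n - p%:R / 24).
  elim: n => [|n ->]; first by rewrite G00.
  by rewrite /= GS eS natrD natrM -/N NE; field.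
have yE n : j + g * (f 0%N - p%:R / 24) = (s n).2 + G n * (f n - p%:R / 24).
  elim: n => [|n ->]; first by rewrite G00.
  by rewrite /= GS fS natrD natrM -/N NE; field.
set x := i + _ in xE *; set y := j + _ in yE *.
have tail01 z : block_set R p q z -> 0 <= z - p%:R / 24 <= 11 / 24.
  by move=> /(block_set_bound q0); rewrite natrD => /andP[? ?]; apply/andP; split; lra.
have sx n : (s n).1 <= x <= (s n).1 + 11 / 24 * G n.
  rewrite (xE n); have /andP[z0 z1] := tail01 _ (eK n); have Gn := G0 n.
  have h1 : 0 <= G n * (e n - p%:R / 24) by rewrite mulr_ge0// ltW.
  have h2 : G n * (e n - p%:R / 24) <= G n * (11 / 24) by rewrite ler_pM2l.
  by apply/andP; split; lra.
have sy n : (s n).2 <= y <= (s n).2 + 11 / 24 * G n.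
  rewrite (yE n); have /andP[z0 z1] := tail01 _ (fK n); have Gn := G0 n.
  have h1 : 0 <= G n * (f n - p%:R / 24) by rewrite mulr_ge0// ltW.
  have h2 : G n * (f n - p%:R / 24) <= G n * (11 / 24) by rewrite ler_pM2l.
  by apply/andP; split; lra.
have s10 n : 0 < (s n).1 by have [] := sInv n.
have dist n : `|t - x * y| <= G n * (x + y + g).
  have [a0 h1 _ /andP[t1 t2]] := sInv n.
  have /andP[x1 x2] := sx n; have /andP[y1 y2] := sy n; have Gn := G0 n.
  have Gg : G n <= g.
    by rewrite /G ler_pdivrMr ?exprn_gt0// ler_peMr ?(ltW g0) ?exprn_ege1 ?(ltW N1).
  have b0 : 0 < (s n).2 by lra.
  move: t1 t2 a0 h1 x1 x2 y1 y2 b0; set a := (s n).1; set b := (s n).2; set H := G n in Gn Gg *.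
  move=> t1 t2 a0 h1 x1 x2 y1 y2 b0.
  have e1 : a * b <= x * y by apply: ler_pM => //; exact: ltW.
  have e2 : x * y <= (a + 11 / 24 * H) * (b + 11 / 24 * H) by apply: ler_pM => //; lra.
  have e3 : (a + 11 / 24 * H) * (b + 11 / 24 * H) - a * b <= H * (x + y + g).
    have -> : (a + 11 / 24 * H) * (b + 11 / 24 * H) - a * b =
      H * (11 / 24 * a + 11 / 24 * b + 121 / 576 * H) by field.
    by rewrite ler_pM2l//; lra.
  by rewrite ler_norml; apply/andP; split; lra.
apply/eqP; rewrite -subr_eq0 -normr_le0; apply/ler_addgt0Pr => eps eps0; rewrite add0r.
set C := x + y + g in dist.
have C0 : 0 < C.
  have [a0 h1 _ _] := sInv 0%N; have /andP[x1 _] := sx 0%N; have /andP[y1 _] := sy 0%N.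
  by rewrite /= in a0 h1 x1 y1; have := G0 0%N; rewrite /C; lra.
have NV1 : `|N^-1| < 1 by rewrite gtr0_norm ?invr_gt0// invf_lt1.
have /cvgrPdist_le /(_ (eps / (g * C)))[|n _ /(_ n (leqnn n))] := @cvg_expr R _ NV1.
  by rewrite divr_gt0// mulr_gt0.
rewrite sub0r normrN ger0_norm; last by rewrite exprn_ge0// invr_ge0 ltW.
rewrite exprVn ler_pdivlMr ?mulr_gt0// => h; apply: (le_trans (dist n)).
by apply: le_trans h; rewrite /G mulrA [N ^- n * g]mulrC.
Qed.

(** Applies [product_cover] to the cylinders of the smallest digit [p * q] and the largest digit
    [(p + 11) * q]; the two numerical hypotheses are its inequalities after clearing
    denominators. *)
Lemma block_set_product_interval p q : (0 < q)%N -> (0 < p <= 13)%N ->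
  (13 * (p * (24 * q + 1) + 11) <= 11 * (24 * (p + 11) * q + p))%N ->
  (p + 11 <= 11 * p * q)%N ->
  contains_interval (product_set (block_set R p q) (block_set R p q)).
Proof.
move=> q0 /andP[p0 p13] c1 c2; set N : R := (24 * q + 1)%:R.
have NE : N = 24 * q%:R + 1 by rewrite /N natrD natrM.
have N0 : 0 < N by rewrite ltr0n; lia.
have q0' : 0 < q%:R :> R by rewrite ltr0n.
have p0' : 0 < p%:R :> R by rewrite ltr0n.
(* [u / N] and [v / N] are the left ends of the two cylinders. *)
pose u : R := p%:R * q%:R + p%:R / 24.
pose v : R := (p%:R + 11) * q%:R + p%:R / 24.
have u0 : 0 < u by rewrite /u; nra.
have v0 : 0 < v by rewrite /v; nra.
have uv1 : 13 * (u + 11 / 24) <= 11 * v.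
  by move: c1; rewrite -(ler_nat R) !(natrM, natrD) /u /v; lra.
have uv2 : v + 11 / 24 <= 11 * q%:R * u.
  move: c2; rewrite -(ler_nat R) !(natrM, natrD) => c2.
  have : (p%:R + 11) * (24 * q%:R + 1) <= 11 * p%:R * q%:R * (24 * q%:R + 1) :> R.
    by rewrite ler_wpM2r//; lra.
  by rewrite /u /v; lra.
pose g := N^-1; have g0 : 0 < g by rewrite invr_gt0.
pose i := u * g; pose j := v * g.
have i0 : 0 < i by rewrite mulr_gt0.
have j0 : 0 < j by rewrite mulr_gt0.
exists (i * j), ((i + 11 / 24 * g) * (j + 11 / 24 * g)); split.
  by apply: ltr_pM => //; rewrite ?ltW//; lra.
move=> t /=; rewrite in_itv /= => tij.
have [||e [f [Ke Kf ->]]] := product_cover q0 p13 i0 g0 _ _ tij.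
- by have := ler_wpM2r (ltW g0) uv1; rewrite /i /j; lra.
- by have := ler_wpM2r (ltW g0) uv2; rewrite /i /j; lra.
have qq : (p * q <= (p + 11) * q)%N by rewrite leq_mul2r leq_addr orbT.
exists ((((p * q)%:R + e) / N)).
  by apply: block_set_cons => //; rewrite leqnn.
exists ((((p + 11) * q)%:R + f) / N).
  by apply: block_set_cons => //; rewrite leqnn andbT.
rewrite /i /j /u /v /g !(natrM, natrD); congr (_ * _); clearbody N; field; exact: lt0r_neq0.
Qed.

End products.

(** * Density of the quotients of powers *)

Section density.
Context (R : realType).
Implicit Types (a b eps : R) (i j k : nat).

(** Dirichlet's pigeonhole argument on the fractional parts of [k * a / b]. *)
Lemma small_integer_combination a b eps : 0 < a -> 0 < b -> 0 < eps ->
  exists i j, [/\ (0 < i)%N, (0 < j)%N & `|i%:R * a - j%:R * b| < eps].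
Proof.
(* With [eps <= a], the case [j = 0] is excluded, since [i * a] would already be too large. *)
move=> a0 b0; wlog epsa : eps / eps <= a => [wl eps0|eps0].
  have [||i [j [? ? h]]] := wl (Num.min eps a).
  - by rewrite ge_min lexx orbT.
  - by rewrite lt_min eps0.
  by exists i, j; split=> //; apply: (lt_le_trans h); rewrite ge_min lexx.
pose n := (Num.truncn (b / eps)).+1.
have nb : b / n%:R < eps.
  by rewrite ltr_pdivrMr ?ltr0n// mulrC -ltr_pdivrMr// truncnS_gt.
pose l k := Num.truncn (k%:R * a / b).
pose fr k := k%:R * a / b - (l k)%:R.
have fr01 k : 0 <= fr k < 1.
  have h : 0 <= k%:R * a / b by rewrite divr_ge0 ?mulr_ge0// ltW.
  have /andP[h1 h2] := truncn_itv h.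
  by rewrite /fr subr_ge0 h1/= ltrBlDl natr1.
pose c k := Num.truncn (n%:R * fr k).
have cn k : (c k < n)%N.
  rewrite /c truncn_lt_nat ?mulr_ge0//; last by case/andP: (fr01 k).
  by rewrite gtr_pMr ?ltr0n//; case/andP: (fr01 k).
have [k [k' [kk' ck]]] : exists k k', (k < k')%N /\ c k = c k'.
  pose g (k : 'I_n.+1) : 'I_n := Ordinal (cn k).
  have /injectivePn[x [y xy gxy]] : ~~ injectiveb g.
    apply/injectiveP => /leq_card; rewrite !card_ord; lia.
  have cxy : c x = c y by have := congr1 val gxy.
  have [h|h|h] := ltngtP x y.
  - by exists x, y.
  - by exists y, x.
  - by move: xy; rewrite (val_inj h) eqxx.
have frd : `|fr k' - fr k| < n%:R^-1.
  have h m : (c m)%:R <= n%:R * fr m < (c m)%:R + 1.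
    have /andP[m0 _] := fr01 m.
    by have := @truncn_itv R (n%:R * fr m) (mulr_ge0 (ler0n _ _) m0); rewrite natr1.
  have /andP[h1 h2] := h k; have /andP[h3 h4] := h k'; rewrite ck in h1 h2.
  have n0 : 0 < n%:R :> R by rewrite ltr0n.
  rewrite -(ltr_pM2l n0) mulfV ?gt_eqF// -[X in X * _](gtr0_norm n0) -normrM mulrBr.
  by rewrite ltr_norml; apply/andP; split; lra.
have key : `|(k' - k)%:R * a - ((l k')%:R - (l k)%:R) * b| < eps.
  apply: le_lt_trans nb.
  have -> : (k' - k)%:R * a - ((l k')%:R - (l k)%:R) * b = b * (fr k' - fr k).
    by rewrite natrB ?(ltnW kk')// /fr; field; rewrite gt_eqF.
  by rewrite normrM (gtr0_norm b0) ler_pM2l// ltW.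
have lll : (l k < l k')%N.
  rewrite -(ltr_nat R) -subr_gt0; set z := _ - _ in key *.
  have : a <= (k' - k)%:R * a by rewrite ler_peMl ?(ltW a0)// ler1n subn_gt0.
  move: key; rewrite ltr_norml => /andP[_ h] h'.
  by rewrite -(pmulr_lgt0 _ b0); move: h; rewrite /z; lra.
exists (k' - k)%N, (l k' - l k)%N; rewrite !subn_gt0; split => //.
by rewrite [X in _ - X * _]natrB// ltnW.
Qed.

(** A nonzero combination [w] smaller than [v - u] cannot step over the interval: start above [v] if
    [w < 0] and below [u] if [w > 0], then add multiples of [w]. *)
Lemma integer_combination_dense a b (u v : R) : 0 < a -> 0 < b ->
  (forall i j, (0 < i)%N -> (0 < j)%N -> i%:R * a != j%:R * b) -> u < v ->
  exists i j, [/\ (0 < i)%N, (0 < j)%N & u < i%:R * a - j%:R * b < v].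
Proof.
move=> a0 b0 irr uv.
have vu0 : 0 < v - u by rewrite subr_gt0.
have [i [j [i0 j0 ij]]] := small_integer_combination a0 b0 vu0.
have := irr i j i0 j0; rewrite -subr_eq0; set w := _ - _ in ij *.
case: ltgtP => // w0 _.
- pose i1 := (Num.truncn (`|v| / a)).+1.
  have i1a : v < i1%:R * a.
    by apply: (le_lt_trans (ler_norm v)); rewrite -ltr_pdivrMr// truncnS_gt.
  have h : 0 <= (i1%:R * a - v) / - w by rewrite divr_ge0 ?oppr_ge0 ?ltW// subr_gt0.
  pose k := (Num.truncn ((i1%:R * a - v) / - w)).+1.
  have /andP[k1 k2] := truncn_itv h.
  have nw0 : 0 < - w by rewrite oppr_gt0.
  rewrite ler_pdivlMr// in k1; rewrite ltr_pdivrMr// in k2.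
  exists (i1 + k * i)%N, (k * j)%N; split; [by rewrite addSn|by rewrite muln_gt0|].
  rewrite -/k in k2.
  have -> : (i1 + k * i)%:R * a - (k * j)%:R * b = i1%:R * a + k%:R * w.
    by rewrite natrD !natrM /w; ring.
  have kE : k%:R = (Num.truncn ((i1%:R * a - v) / - w))%:R + 1 :> R by rewrite natr1.
  move: ij; rewrite ltr0_norm// => ij.
  by apply/andP; split; [rewrite kE mulrDl; lra|lra].
- pose j1 := (Num.truncn (`|u| / b)).+1.
  have j1b : - u < j1%:R * b.
    by apply: (le_lt_trans (ler_norm (- u))); rewrite normrN -ltr_pdivrMr// truncnS_gt.
  have h : 0 <= (u + j1%:R * b) / w by rewrite divr_ge0 ?ltW//; lra.
  pose k := (Num.truncn ((u + j1%:R * b) / w)).+1.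
  have /andP[k1 k2] := truncn_itv h.
  rewrite ler_pdivlMr// in k1; rewrite ltr_pdivrMr// in k2.
  exists (k * i)%N, (j1 + k * j)%N; split; [by rewrite muln_gt0|by rewrite addSn|].
  rewrite -/k in k2.
  have -> : (k * i)%:R * a - (j1 + k * j)%:R * b = k%:R * w - j1%:R * b.
    by rewrite natrD !natrM /w; ring.
  have kE : k%:R = (Num.truncn ((u + j1%:R * b) / w))%:R + 1 :> R by rewrite natr1.
  move: ij; rewrite gtr0_norm// => ij.
  by apply/andP; split; [lra|rewrite kE mulrDl; lra].
Qed.

Lemma power_quotient_dense (A B : nat) (u v : R) : (1 < A)%N -> (1 < B)%N ->
  coprime A B -> 0 < u -> u < v ->
  exists i j, [/\ (0 < i)%N, (0 < j)%N & u < A%:R ^+ i / B%:R ^+ j < v].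
Proof.
move=> A1 B1 AB u0 uv; have v0 : 0 < v by apply: lt_trans uv.
have A0 : 0 < A%:R :> R by rewrite ltr0n; lia.
have B0 : 0 < B%:R :> R by rewrite ltr0n; lia.
have [||i j i0 j0||i [j [i0 j0 ij]]] :=
    @integer_combination_dense (ln A%:R) (ln B%:R) (ln u) (ln v).
- by rewrite ln_gt0// ltr1n.
- by rewrite ln_gt0// ltr1n.
(* Coprime powers agree only if both are 1, so the two logarithms are incommensurable. *)
- apply/eqP => h.
  have : A%:R ^+ i = B%:R ^+ j :> R.
    apply: ln_inj; rewrite ?posrE ?exprn_gt0// !lnXn// .
    by rewrite -[LHS]mulr_natl h mulr_natl.
  move=> /eqP; rewrite -!natrX eqr_nat => /eqP ABij.
  have : coprime (A ^ i) (B ^ j) by rewrite coprimeXl// coprimeXr.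
  rewrite ABij /coprime gcdnn => /eqP.
  by have := @ltn_exp2l B 0 j B1; rewrite j0 expn0; lia.
- by rewrite ltr_ln ?posrE.
exists i, j; split=> //.
have lnE : ln (A%:R ^+ i / B%:R ^+ j) = i%:R * ln A%:R - j%:R * ln B%:R :> R.
  by rewrite ln_div ?posrE ?exprn_gt0// !lnXn// !mulr_natl.
by rewrite -lnE !ltr_ln ?posrE ?divr_gt0 ?exprn_gt0 in ij.
Qed.

(* After scaling by integer powers of the bases, points of the two sets have
   their fractional parts in the disjoint intervals [13/24, 1] and [1/24, 1/2]. *)
Lemma power_quotient_notin q t i j : (0 < q)%N -> (0 < t)%N ->
  ~ division_set (block_set R 1 t) (block_set R 13 q)
      ((24 * q + 1)%:R ^+ i / (24 * t + 1)%:R ^+ j).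
Proof.
move=> q0 t0 [y Fy [x Ex]]; set A : R := (24 * q + 1)%:R; set B : R := (24 * t + 1)%:R.
have [k [e [Ee -> _]]] := block_set_prefix i q0 (leqnn 13) Ex.
have [m [f [Ff -> _]]] := block_set_prefix j t0 (isT : 1 <= 13)%N Fy.
rewrite -/A -/B.
have A0 : A ^+ i != 0 by rewrite expf_neq0// pnatr_eq0; lia.
have B0 : B ^+ j != 0 by rewrite expf_neq0// pnatr_eq0; lia.
have /andP[e0 e1] := block_set_bound q0 Ee.
have /andP[f0 f1] := block_set_bound t0 Ff.
have ke0 : k%:R + e != 0.
  by rewrite gt_eqF//; have := ler0n R k; lra.
move=> h.
have : m%:R + f = k%:R + e.
  have -> : m%:R + f = (m%:R + f) / B ^+ j / ((k%:R + e) / A ^+ i) * (k%:R + e) * B ^+ j / A ^+ i.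
    by field; rewrite A0 B0 ke0.
  by rewrite h; field; rewrite A0 B0.
move=> {}h; have [mk|mk|mk] := ltngtP m k.
- have : m%:R + 1 <= k%:R :> R by rewrite natr1 ler_nat.
  by lra.
- have : k%:R + 1 <= m%:R :> R by rewrite natr1 ler_nat.
  by lra.
- by move: h; rewrite mk; lra.
Qed.

Lemma division_set_nowhere_dense q t : (0 < q)%N -> (0 < t)%N ->
  coprime (24 * q + 1) (24 * t + 1) ->
  nowhere_dense (division_set (block_set R 1 t) (block_set R 13 q)).
Proof.
move=> q0 t0 cop; set V := division_set _ _.
have Epos : block_set R 13 q `<=` [set x | 0 < x].
  by move=> x /(block_set_bound q0) /andP[h _] /=; lra.
have Vcl : closed V.
  apply: compact_closed; first exact: Rhausdorff.
  by apply: division_set_compact => //; exact: block_set_compact.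
rewrite /nowhere_dense -(closure_id V).1//; apply/seteqP; split=> // v /nbhs_ballP[eps /= eps0 epsV].
have v0 : 0 < v.
  have [y /(block_set_bound t0)/andP[y0 _] [x /Epos/= x0 <-]] := epsV _ (ballxx _ eps0).
  by rewrite divr_gt0//; lra.
(* The bound [v / 2] keeps the interval positive, and [v - eps] keeps it inside the ball. *)
have [|||||i [j [_ _ /andP[h1 h2]]]] := @power_quotient_dense (24 * q + 1) (24 * t + 1) (Num.max (v - eps) (v / 2)) v.
- by lia.
- by lia.
- by [].
- by rewrite lt_max divr_gt0// orbT.
- by rewrite gt_max; apply/andP; split; lra.
apply: (@power_quotient_notin q t i j q0 t0); apply: epsV.
move: h1; rewrite gt_max => /andP[h1 _].
by rewrite /ball/= ltr_norml; apply/andP; split; lra.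
Qed.

End density.

(** * Hausdorff dimension *)

Section dimension.
Context (R : realType).
Implicit Types (s t x : R) (p q n : nat).

(** Covers by [n] intervals of length [1 / n] have total weight at most [n ^ (1 - s)], which tends
    to 0. *)
Lemma hausdorff_measure_gt1 (A : set R) s : A `<=` `[0, 1] -> 1 < s ->
  hausdorff_measure s A = 0%E.
Proof.
move=> A01 s1; have s0 : 0 < s by apply: lt_trans s1.
apply/eqP; rewrite eq_le; apply/andP; split; last first.
  apply: le_trans (ereal_sup_ubound _); last by exists 1 => //=.
  apply: le_ereal_inf_tmp => _ [U _ <-]; apply: nneseries_ge0 => i _ _.
  by rewrite /diam_pow; case: ifP => // _; exact: poweR_ge0.
apply: ge_ereal_sup => _ [delta /= delta0 <-].
apply/lee_addgt0Pr => /= eps eps0; rewrite add0e.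
have [n nd neps] : exists2 n : nat, (0 < n)%N /\ n%:R^-1 <= delta &
    n%:R * (n%:R^-1 `^ s) <= eps :> R.
  (* The two entries of the maximum ensure [1 / m <= delta] and [m ^ (1 - s) <= eps]. *)
  pose m := (Num.truncn (Num.max delta^-1 (eps `^ (- (s - 1)^-1)))).+1.
  have m0 : 0 < m%:R :> R by rewrite ltr0n.
  have := truncnS_gt (Num.max delta^-1 (eps `^ (- (s - 1)^-1))).
  rewrite -/m gt_max => /andP[md me].
  exists m; first by split=> //; rewrite invf_ple ?posrE// ltW.
  have -> : m%:R * m%:R^-1 `^ s = (m%:R `^ (s - 1))^-1.
    rewrite -powRN opprB powRD; last by rewrite (gt_eqF m0) implybT.
    by rewrite powRr1 ?ltW// powRN -powR_inv1 ?ltW// -powRrM mulN1r powRN.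
  have -> : eps = ((eps `^ (- (s - 1)^-1)) `^ (s - 1))^-1.
    rewrite -powRrM mulNr mulVf ?gt_eqF ?subr_gt0// powRN powRr1 ?ltW//.
    by rewrite invrK.
  rewrite lef_pV2 ?posrE ?powR_gt0//.
  by apply: ge0_ler_powR; rewrite ?nnegrE ?powR_ge0 ?subr_ge0 ?ltW.
case: nd => n0 nd; have n0' : 0 < n%:R :> R by rewrite ltr0n.
pose U i : set R := if (i < n)%N then `[i%:R / n%:R, i.+1%:R / n%:R]%classic else set0.
have Udiam i : (diam (U i) <= (n%:R^-1)%:E)%E.
  apply: ge_ereal_sup => _ [->|[x Ux [y Uy <-]]]; first by rewrite lee_fin invr_ge0.
  move: Ux Uy; rewrite /U; case: ifP => // _ /=; rewrite !in_itv/=.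
  rewrite -natr1 mulrDl mul1r => /andP[? ?] /andP[? ?].
  by rewrite lee_fin ler_norml; apply/andP; split; lra.
have Upow i : (0 <= diam_pow s (U i) <= ((n%:R^-1) `^ s)%:E)%E.
  rewrite /diam_pow; case: ifP => _; first by rewrite lexx lee_fin powR_ge0.
  rewrite poweR_ge0 andTb -poweR_EFin; apply: gt0_ler_poweR; rewrite ?(ltW s0)//.
  - rewrite in_itv/= leey andbT; apply: ereal_sup_ubound; by left.
  - by rewrite in_itv/= leey andbT lee_fin invr_ge0.
apply: (@le_trans _ _ (\sum_(0 <= i <oo) diam_pow s (U i))%E).
  apply: ereal_inf_lbound; exists U => //; split.
    by move=> i; apply: (le_trans (Udiam i)); rewrite lee_fin.
  move=> x /A01 /=; rewrite in_itv/= => /andP[x0 x1].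
  (* The point 1 belongs to the last interval, whereas truncation would give index [n]. *)
  have [->|xn1] := eqVneq x 1.
    exists n.-1 => //; rewrite /U prednK// leqnn /= in_itv/= divff ?gt_eqF// lexx andbT.
    by rewrite ler_pdivrMr// mul1r ler_nat leq_pred.
  have x1' : x < 1 by rewrite lt_neqAle xn1.
  have nx : 0 <= n%:R * x by rewrite mulr_ge0// ltW.
  exists (Num.truncn (n%:R * x)) => //.
  have /andP[h1 h2] := truncn_itv nx.
  rewrite /U truncn_lt_nat// gtr_pMr// x1'/= in_itv/=.
  by rewrite ler_pdivrMr// ler_pdivlMr// [x * _]mulrC h1/= ltW.
rewrite (nneseries_split 0 n); last by move=> k _; case/andP: (Upow k).
rewrite add0n [X in (_ + X)%E]eseries0 ?adde0; last first.
  by move=> i ni _; rewrite /U ltnNge ni/= /diam_pow eqxx.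
apply: (@le_trans _ _ (\sum_(0 <= i < n) ((n%:R^-1) `^ s)%:E)%E).
  by apply: lee_sum => i _; case/andP: (Upow i).
rewrite sumEFin lee_fin sumr_const_nat subn0 -[X in X <= _]mulr_natl.
exact: neps.
Qed.

Lemma hausdorff_dim_le1 (A : set R) : A `<=` `[0, 1] -> (hausdorff_dim A <= 1)%E.
Proof.
move=> A01; apply/lee_addgt0Pr => eps eps0; apply: ereal_inf_lbound.
exists (1 + eps) => //; split; first by lra.
by apply: hausdorff_measure_gt1 => //; lra.
Qed.

(* [block_code p q t x]: the base-(11q+1) digits of [t], shifted by [p * q],
   are the digits of [x]. *)
Definition block_code p q (t x : R) := exists (c : nat -> nat) (tau e : nat -> R),
  [/\ tau 0%N = t, e 0%N = x, forall n, 0 <= tau n <= 1, forall n, block_set R p q (e n) &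
   forall n, tau n.+1 = (11 * q + 1)%:R * tau n - (c n)%:R /\
     e n.+1 = (24 * q + 1)%:R * e n - (p * q + c n)%:R].

(** The code is the base-[M] expansion of [t]; starting from [t < 1], every remainder stays below 1,
    so every digit is at most [11 * q]. *)
Lemma block_code_ex p q t : (0 < q)%N -> (p <= 13)%N -> 0 <= t < 1 ->
  exists2 x, block_set R p q x & block_code p q t x.
Proof.
move=> q0 p13 t01; set M : R := (11 * q + 1)%:R.
pose tau := fix tau n := if n is m.+1 then M * tau m - (Num.truncn (M * tau m))%:R else t.
have tau01 n : 0 <= tau n < 1.
  elim: n => [//|n /andP[h0 h1]] /=.
  have h : 0 <= M * tau n by rewrite mulr_ge0.
  have /andP[g1 g2] := truncn_itv h.
  by rewrite subr_ge0 g1 ltrBlDl natr1.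
pose c n := Num.truncn (M * tau n).
have cq n : (c n <= 11 * q)%N.
  have /andP[h0 h1] := tau01 n.
  have : (c n < 11 * q + 1)%N.
    by rewrite truncn_lt_nat ?mulr_ge0// gtr_pMr// ltr0n addn1.
  by rewrite addn1.
have [|e [eK eS]] := @block_set_tails R p q (fun n => p * q + c n)%N q0 p13.
  by move=> n; rewrite leq_addr/= mulnDl leq_add2l.
exists (e 0%N); first exact: eK.
exists c, tau, e; split=> // n.
by have /andP[-> /ltW] := tau01 n.
Qed.

(** At the first index [n] where the digits differ, the codes are within [M ^- n], while the gaps of
    the block set keep the points at least [13 / 24 * N ^- (n + 1)] apart. The exponent turns
    [N ^- n] into [M ^- n]. *)
Lemma block_code_holder p q t t' x x' : (0 < q)%N ->
  block_code p q t x -> block_code p q t' x' ->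
  `|t - t'| <= (24 / 13 * (24 * q + 1)%:R * `|x - x'|) `^
     (ln (11 * q + 1)%:R / ln (24 * q + 1)%:R).
Proof.
move=> q0 [c [tau [e [<- <- tau01 eK rec]]]] [c' [tau' [e' [<- <- tau01' eK' rec']]]].
set M : R := (11 * q + 1)%:R; set N : R := (24 * q + 1)%:R.
have M1 : 1 < M by rewrite ltr1n; lia.
have N1 : 1 < N by rewrite ltr1n; lia.
have M0 : 0 < M by apply: lt_trans M1.
have N0 : 0 < N by apply: lt_trans N1.
have agree n : (forall k, (k < n)%N -> c k = c' k) ->
    tau 0%N - tau' 0%N = (tau n - tau' n) / M ^+ n /\ e 0%N - e' 0%N = (e n - e' n) / N ^+ n.
  elim: n => [|n IH] cc; first by rewrite !expr0 !divr1.
  have [|-> ->] := IH; first by move=> k kn; exact/cc/ltnW.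
  have [-> ->] := rec n; have [-> ->] := rec' n; rewrite (cc n)// -/M -/N !exprS.
  split.
    by clearbody M; field; rewrite !gt_eqF ?exprn_gt0.
  by clearbody N; field; rewrite !gt_eqF ?exprn_gt0.
have tauM n : (forall k, (k < n)%N -> c k = c' k) -> `|tau 0%N - tau' 0%N| <= M ^- n.
  move=> /agree[-> _]; rewrite normrM [X in _ * X]gtr0_norm ?invr_gt0 ?exprn_gt0//.
  rewrite ler_piMl ?invr_ge0 ?exprn_ge0 ?(ltW M0)//.
  have /andP[? ?] := tau01 n; have /andP[? ?] := tau01' n.
  by rewrite ler_norml; apply/andP; split; lra.
have [cc|/existsNP ex] := pselect (forall k, c k = c' k).
  apply: (@le_trans _ _ 0); last exact: powR_ge0.
  apply/ler_addgt0Pr => eps eps0; rewrite add0r.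
  have MV1 : `|M^-1| < 1 by rewrite gtr0_norm ?invr_gt0// invf_lt1.
  have /cvgrPdist_le /(_ _ eps0)[n _ /(_ n (leqnn n))] := @cvg_expr R _ MV1.
  rewrite sub0r normrN ger0_norm; last by rewrite exprn_ge0// invr_ge0 ltW.
  rewrite exprVn => h; apply: le_trans h; apply: tauM => k _; exact: cc.
have {}ex : exists k, c k != c' k by case: ex => k /eqP; exists k.
case: (ex_minnP ex) => n ncc nmin.
have cc k : (k < n)%N -> c k = c' k.
  by move=> kn; apply/eqP; apply: contraLR kn => /nmin; rewrite -leqNgt.
apply: (le_trans (tauM n cc)).
have MN : M ^- n = (N ^- n) `^ (ln M / ln N).
  rewrite /powR gt_eqF ?invr_gt0 ?exprn_gt0//.
  rewrite lnV ?posrE ?exprn_gt0// lnXn// mulrN mulrnAr divfK; last by rewrite gt_eqF// ln_gt0.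
  by rewrite expRN -mulr_natl expRM_natl lnK ?posrE.
rewrite MN; apply: ge0_ler_powR.
- by rewrite divr_ge0// ln_ge0// ltW.
- by rewrite nnegrE invr_ge0 exprn_ge0// ltW.
- by rewrite nnegrE !mulr_ge0// ltW.
have [_ ->] := agree n cc.
have : 13 / 24 / N <= `|e n - e' n|.
  rewrite leNgt; apply/negP => h; move/eqP: ncc; apply.
  have h1 := eK n.+1; have h2 := eK' n.+1.
  rewrite (rec n).2 in h1; rewrite (rec' n).2 in h2.
  by have := block_set_digit_inj q0 h1 h2 h => /addnI.
rewrite normrM [`|_^-1|]gtr0_norm ?invr_gt0 ?exprn_gt0// => h.
rewrite [X in X <= _](_ : _ = 24 / 13 * N * (13 / 24 / N / N ^+ n)); last first.
  by clearbody N; field; rewrite !gt_eqF ?exprn_gt0.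
rewrite ler_pM2l; last by rewrite mulr_gt0.
by rewrite ler_pM2r// invr_gt0 exprn_gt0.
Qed.

Lemma diam_ge (U : set R) x x' : U x -> U x' -> (`|x - x'|%:E <= diam U)%E.
Proof. by move=> Ux Ux'; apply: ereal_sup_ubound; right; exists x => //; exists x'. Qed.

(** If the measure vanished for some [s < s0], a cover of small weight would be transported by the
    codes to a cover of [0, 1) of total length below 1. *)
Lemma hausdorff_dim_block_set_ge p q : (0 < q)%N -> (p <= 13)%N ->
  ((ln (11 * q + 1)%:R / ln (24 * q + 1)%:R)%:E <= hausdorff_dim (block_set R p q))%E.
Proof.
move=> q0 p13; set s0 := ln _ / ln _; set N : R := (24 * q + 1)%:R.
have N1 : 1 < N by rewrite ltr1n; lia.
have s0ge0 : 0 <= s0 by rewrite divr_ge0// ln_ge0// ler1n; lia.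
apply: le_ereal_inf_tmp => _ [s [s_ge0 Hs0] <-]; rewrite lee_fin leNgt; apply/negP => ss0.
(* Chosen so that an interval of length [2 * r i] is at most [C] times the weight of [U i], using
   [D i <= 1] and [s < s0]. *)
pose C : R := 2 * (24 / 13 * N) `^ s0.
have B0 : 0 < 24 / 13 * N by rewrite mulr_gt0//; apply: lt_trans N1.
have C0 : 0 < C by rewrite mulr_gt0// powR_gt0.
have : (hausdorff_premeasure s 1 (block_set R p q) < (C^-1)%:E)%E.
  apply: (@le_lt_trans _ _ 0%E); last by rewrite lte_fin invr_gt0.
  by rewrite -Hs0; apply: ereal_sup_ubound; exists 1 => /=.
move=> /ereal_inf_lt[_ [U [U1 KU] <-] sumU].
have Ufin i : diam (U i) = (fine (diam (U i)))%:E.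
  have : (0 <= diam (U i) <= 1)%E by rewrite U1 andbT; apply: ereal_sup_ubound; left.
  by case: (diam (U i)) => [z| |] //= /andP[].
pose D i := fine (diam (U i)).
have D01 i : 0 <= D i <= 1.
  by rewrite -!lee_fin -Ufin U1 andbT; apply: ereal_sup_ubound; left.
pose r i := (24 / 13 * N * D i) `^ s0.
pose T i : set R := [set t | exists2 x, U i x & block_code p q t x].
have Tr i t t' : T i t -> T i t' -> `|t - t'| <= r i.
  move=> [x Ux tx] [x' Ux' tx']; apply: (le_trans (block_code_holder q0 tx tx')).
  apply: ge0_ler_powR => //; rewrite ?nnegrE ?mulr_ge0//; try exact: ltW.
  - by case/andP: (D01 i).
  - by rewrite ler_pM2l// -lee_fin -Ufin; exact: diam_ge.
(* [T i] need not be measurable, so it is enclosed in an interval of radius [r i] about one of its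
   points. *)
have /choice[J JP] : forall i, exists J : set R, [/\ measurable J, T i `<=` J &
    (lebesgue_measure J <= C%:E * diam_pow s (U i))%E].
  move=> i; have [T0|Tn] := pselect (T i = set0).
    exists set0; split; [exact: measurable0|by rewrite T0|].
    rewrite measure0 mule_ge0 ?lee_fin ?(ltW C0)//.
    by rewrite /diam_pow; case: ifP => // _; exact: poweR_ge0.
  have [t0 Tt0] : exists t, T i t.
    by apply: contra_notP Tn => /forallNP h; apply/seteqP; split=> // t /h.
  have U0 : U i != set0.
    by apply/eqP => U0; case: Tt0 => x; rewrite U0.
  exists (`[t0 - r i, t0 + r i]%classic); split; first exact: measurable_itv.
    move=> t Tt /=; rewrite in_itv/=.
    by have := Tr _ _ _ Tt Tt0; rewrite ler_norml => /andP[? ?]; apply/andP; split; lra.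
  have r2 : 2 * r i <= C * D i `^ s.
    have /andP[D0 D1] := D01 i.
    rewrite /r /C powRM//; last exact: ltW.
    rewrite mulrA ler_pM2l; last by rewrite mulr_gt0// powR_gt0.
    have [->|Dn0] := eqVneq (D i) 0.
      by rewrite powR0 ?powR_ge0// gt_eqF// (le_lt_trans s_ge0).
    by apply: ger_powR; rewrite ?D1 ?andbT ?lt_neqAle ?D0 ?(eq_sym 0) ?Dn0//= ltW.
  have r0 : 0 <= r i by exact: powR_ge0.
  rewrite lebesgue_measure_itv/= lte_fin /diam_pow (negbTE U0) Ufin -/(D i) poweR_EFin.
  case: ifP => _; last by rewrite -EFinM lee_fin mulr_ge0// ?powR_ge0// ltW.
  by rewrite -EFinB -EFinM lee_fin; lra.
have : (lebesgue_measure (`[0%R, 1%R[%classic : set R) <= \sum_(0 <= i <oo) lebesgue_measure (J i))%E.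
  apply: measure_sigma_subadditive => //; first by move=> i; have [] := JP i.
  move=> t /=; rewrite in_itv/= => t01.
  have [x Kx tx] := block_code_ex q0 p13 t01.
  have [i _ Ux] := KU _ Kx; exists i => //.
  by have [_ TJ _] := JP i; apply: TJ; exists x.
rewrite lebesgue_measure_itv/= lte_fin ltr01 sube0 leNgt => /negP; apply.
apply: (@le_lt_trans _ _ (\sum_(0 <= i <oo) C%:E * diam_pow s (U i))%E).
  by apply: lee_nneseries => // i _; have [] := JP i.
rewrite nneseriesZl; last first.
  by move=> i _; rewrite /diam_pow; case: ifP => // _; exact: poweR_ge0.
by rewrite -lte_pdivlMl// mule1.
Qed.

Lemma hausdorff_dim_block_set_cvg p b (u : nat -> nat) : (p <= 13)%N -> (2 < b)%N ->
  (forall r, 24 * u r + 1 = b ^ r)%N ->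
  hausdorff_dim (block_set R p (u r)) @[r --> \oo] --> 1%E.
Proof.
move=> p13 b2 uE.
have b1 : 1 < b%:R :> R by rewrite ltr1n; lia.
have u0 r : (0 < r)%N -> (0 < u r)%N.
  move=> r0; have := uE r; have := @ltn_exp2l b 0 r ltac:(lia).
  by rewrite r0 expn0; lia.
have lim1 : (1 - r.+1%:R^-1 : R)%:E @[r --> \oo] --> 1%:E.
  apply: cvg_EFin; first exact: nearW.
  rewrite -[X in _ --> X]subr0; apply: cvgB; first exact: cvg_cst.
  exact: cvg_harmonic.
rewrite -cvg_shiftS /=; apply: (squeeze_cvge _ lim1); last exact: cvg_cst.
apply: nearW => r; apply/andP; split; last first.
  apply: hausdorff_dim_le1 => x /(block_set_bound (u0 _ _)) -/(_ isT) /andP[x0 x1] /=.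
  rewrite in_itv/=; apply/andP; split; first by apply: le_trans x0; rewrite divr_ge0.
  by apply: (le_trans x1); rewrite ler_pdivrMr// mul1r ler_nat; lia.
apply: le_trans (hausdorff_dim_block_set_ge (u0 _ _) p13) => //; rewrite lee_fin uE.
have lb0 : 0 < ln b%:R :> R by rewrite ln_gt0.
have -> : ln (b ^ r.+1)%:R = r.+1%:R * ln b%:R :> R.
  by rewrite natrX lnXn ?mulr_natl// (lt_trans ltr01).
rewrite ler_pdivlMr; last by rewrite mulr_gt0.
(* From [24 * q + 1 = b ^ (r + 1)] and [b >= 3] follows [11 * q + 1 >= b ^ r], so the ratio of
   logarithms is at least [r / (r + 1)]. *)
have -> : (1 - r.+1%:R^-1) * (r.+1%:R * ln b%:R) = ln (b ^ r)%:R :> R.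
  rewrite natrX lnXn ?(lt_trans ltr01)// -[RHS]mulr_natl mulrA mulrBl mul1r mulVf//.
  by rewrite -natr1 addrK.
rewrite ler_ln ?posrE ?ltr0n//; last 2 first.
- by rewrite expn_gt0; lia.
- by lia.
have := uE r.+1; rewrite expnS ler_nat => h.
have : (3 * b ^ r <= b * b ^ r)%N by rewrite leq_mul2r b2 orbT.
by lia.
Qed.

End dimension.

(** * Exponential sums *)

Section trigonometric_sums.
Context (R : realType).
Implicit Types (x y theta : R) (k j L : nat).

Lemma sin_lipschitz x y : `|sin x - sin y| <= `|x - y|.
Proof.
wlog yx : x y / y <= x => [H|].
  by have [/H//|/ltW/H] := leP y x; rewrite distrC [`|y - x|]distrC.
have [|c _ ->] := @MVT_segment R sin cos y x yx (fun z _ => is_derive_sin z).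
  by apply: continuous_subspaceT => z; exact: continuous_sin.
by rewrite normrM ler_piMl// cos_max.
Qed.

Lemma cos_lipschitz x y : `|cos x - cos y| <= `|x - y|.
Proof.
rewrite -!sinDpihalf; apply: (le_trans (sin_lipschitz _ _)).
by rewrite opprD addrACA subrr addr0.
Qed.

Lemma one_minus_cos x : 1 - cos x = 2 * sin (x / 2) ^+ 2.
Proof.
have {1}-> : x = x / 2 + x / 2 by field.
by rewrite cosD -!expr2; have := cos2Dsin2 (x / 2); lra.
Qed.

Lemma cos_ge_half x : `|x| <= 1 -> 1 / 2 <= cos x.
Proof.
move=> x1; have := one_minus_cos x.
have : `|sin (x / 2)| <= 1 / 2.
  have := sin_lipschitz (x / 2) 0; rewrite sin0 !subr0 => /le_trans; apply.
  by rewrite normrM [`|2^-1|]ger0_norm//; lra.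
rewrite ler_norml => /andP[s1 s2].
by have : sin (x / 2) ^+ 2 <= 1 / 4; [rewrite expr2; nra|lra].
Qed.

Lemma sin_ge_half x : 0 <= x <= 1 -> x / 2 <= sin x.
Proof.
move=> /andP[x0 x1].
have [|c + h] := @MVT_segment R sin cos 0 x x0 (fun z _ => is_derive_sin z).
  by apply: continuous_subspaceT => z; exact: continuous_sin.
rewrite in_itv/= => /andP[c0 cx].
have : 1 / 2 <= cos c by apply: cos_ge_half; rewrite ger0_norm// (le_trans cx).
by move: h; rewrite sin0 !subr0 => -> ?; nra.
Qed.

Lemma one_minus_cos_ge x : `|x| <= 2 -> x ^+ 2 / 8 <= 1 - cos x.
Proof.
move=> x2; rewrite -(cos_norm x) -(real_normK (num_real x)).
have h : 0 <= `|x| / 2 <= 1 by apply/andP; split; have := normr_ge0 x; lra.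
rewrite one_minus_cos; have := sin_ge_half h; case/andP: h => h0 h1.
set s := sin _; set y := `|x| in h0 h1 * => hs.
rewrite !expr2; nra.
Qed.

Lemma sum_const_seq (T : Type) (s : seq T) (c : R) : \sum_(x <- s) c = (size s)%:R * c.
Proof. by rewrite big_const_seq count_predT iter_addr_0 mulr_natl. Qed.

(* The squared modulus of [\sum_(x <- s) exp (i * phi x)]. *)
Definition exp_sum_sq (T : Type) (s : seq T) (phi : T -> R) : R :=
  (\sum_(x <- s) cos (phi x)) ^+ 2 + (\sum_(x <- s) sin (phi x)) ^+ 2.

Lemma exp_sum_sqE (T : Type) (s : seq T) (phi : T -> R) :
  exp_sum_sq s phi = \sum_(x <- s) \sum_(y <- s) cos (phi x - phi y).
Proof.
rewrite /exp_sum_sq !expr2 !big_distrlr /= -big_split; apply: eq_bigr => x _ /=.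
by rewrite -big_split; apply: eq_bigr => y _; rewrite cosB.
Qed.

Lemma exp_sum_sq_ge0 (T : Type) (s : seq T) (phi : T -> R) : 0 <= exp_sum_sq s phi.
Proof. by rewrite addr_ge0 ?sqr_ge0. Qed.

Lemma exp_sum_sq_le (T : Type) (s : seq T) (phi : T -> R) :
  exp_sum_sq s phi <= (size s)%:R ^+ 2.
Proof.
rewrite exp_sum_sqE expr2.
apply: (@le_trans _ _ (\sum_(x <- s) \sum_(y <- s) 1)).
  by apply: ler_sum => x _; apply: ler_sum => y _; exact: cos_le1.
by rewrite !sum_const_seq mulr1.
Qed.

Lemma exp_sum_sq_shift (T : Type) (s : seq T) (phi : T -> R) (c : R) :
  exp_sum_sq s (fun z : T => c + phi z) = exp_sum_sq s phi.
Proof.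
rewrite !exp_sum_sqE; apply: eq_bigr => x _; apply: eq_bigr => y _.
by rewrite opprD addrACA subrr add0r.
Qed.

Lemma exp_sum_sq_opp (T : Type) (s : seq T) (phi : T -> R) :
  exp_sum_sq s (fun z : T => - phi z) = exp_sum_sq s phi.
Proof.
rewrite !exp_sum_sqE; apply: eq_bigr => x _; apply: eq_bigr => y _.
by rewrite -opprD cosN.
Qed.

Lemma exp_sum_sq_prod (T U : Type) (s : seq T) (t : seq U) (phi : T -> R) (psi : U -> R) :
  exp_sum_sq [seq (a, b) | a <- s, b <- t] (fun z : T * U => phi z.1 + psi z.2) =
  exp_sum_sq s phi * exp_sum_sq t psi.
Proof.
rewrite /exp_sum_sq !big_allpairs_dep/=.
under eq_bigr do under eq_bigr do rewrite cosD.
under [X in _ + X ^+ 2]eq_bigr do under eq_bigr do rewrite sinD.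
under eq_bigr do rewrite sumrB -!big_distrr/=.
under [X in _ + X ^+ 2]eq_bigr do rewrite big_split -!big_distrr/=.
rewrite sumrB big_split/= -!big_distrl/=.
ring.
Qed.

(** Cauchy-Schwarz against the constant 1, from [2 * a * b <= a ^ 2 + b ^ 2]. *)
Lemma sum_sqr_le (T : Type) (s : seq T) (a : T -> R) :
  (\sum_(x <- s) a x) ^+ 2 <= (size s)%:R * \sum_(x <- s) a x ^+ 2.
Proof.
rewrite expr2 big_distrlr /=.
apply: (@le_trans _ _ (\sum_(x <- s) \sum_(y <- s) (a x ^+ 2 / 2 + a y ^+ 2 / 2))).
  apply: ler_sum => x _; apply: ler_sum => y _.
  by have := sqr_ge0 (a x - a y); rewrite sqrrB => h; lra.
under [X in X <= _]eq_bigr do rewrite big_split/= sum_const_seq.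
rewrite big_split/= sum_const_seq -big_distrr/= -mulrDr.
by rewrite -big_split/=; under eq_bigr do rewrite -splitr.
Qed.

(** Sine and cosine are 1-Lipschitz, so each component moves by at most [size s * eps]; then
    [a ^ 2 <= 2 * b ^ 2 + 2 * (a - b) ^ 2]. *)
Lemma exp_sum_sq_lipschitz (T : eqType) (s : seq T) (phi psi : T -> R) (eps : R) :
  (forall z, z \in s -> `|phi z - psi z| <= eps) ->
  exp_sum_sq s phi <= 2 * exp_sum_sq s psi + 4 * ((size s)%:R * eps) ^+ 2.
Proof.
move=> h.
have key (f : R -> R) : (forall x y, `|f x - f y| <= `|x - y|) ->
    (\sum_(x <- s) f (phi x)) ^+ 2 <=
    2 * (\sum_(x <- s) f (psi x)) ^+ 2 + 2 * ((size s)%:R * eps) ^+ 2.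
  move=> fl; set a := \sum_(x <- s) _; set b := \sum_(x <- s) _.
  have ab : `|a - b| <= (size s)%:R * eps.
    rewrite /a /b -sumrB; apply: (le_trans (ler_norm_sum _ _ _)).
    rewrite big_seq; apply: (@le_trans _ _ (\sum_(x <- s | x \in s) eps)).
      by apply: ler_sum => x xs; apply: (le_trans (fl _ _)); exact: h.
    by rewrite -big_seq sum_const_seq.
  set e := _ * eps in ab *.
  have : (a - b) ^+ 2 <= e ^+ 2.
    by rewrite -(real_normK (num_real (a - b))) lerXn2r// nnegrE// (le_trans _ ab).
  have := sqr_ge0 (a - 2 * b); rewrite !expr2 => ? ?; nra.
have := key cos cos_lipschitz; have := key sin sin_lipschitz.
rewrite /exp_sum_sq; lra.
Qed.

(* The Fejer kernel, up to normalization. *)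
Definition fejer L theta : R := exp_sum_sq (index_iota 0 L) (fun j => j%:R * theta).

Lemma fejer_le L theta : fejer L theta <= L%:R ^+ 2.
Proof. by apply: (le_trans (exp_sum_sq_le _ _)); rewrite size_iota subn0. Qed.

Lemma fejer_ge L theta : L%:R * `|theta| <= 1 -> L%:R ^+ 2 / 4 <= fejer L theta.
Proof.
move=> Lt; rewrite /fejer /exp_sum_sq.
have : L%:R / 2 <= \sum_(x <- index_iota 0 L) cos (x%:R * theta).
  apply: (@le_trans _ _ (\sum_(0 <= j < L) (1 / 2))).
    by rewrite sumr_const_nat subn0 -[X in _ <= X]mulr_natl mul1r.
  rewrite big_nat [X in _ <= X]big_nat; apply: ler_sum => j /andP[_ jL].
  apply: cos_ge_half; rewrite normrM normr_nat; apply: le_trans Lt.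
  by rewrite ler_wpM2r// ler_nat ltnW.
set c := \sum_(_ <- _) cos _; set d := \sum_(_ <- _) sin _ => h.
have := ler0n R L; have := sqr_ge0 d; rewrite !expr2; nra.
Qed.

(** The geometric sum telescopes after multiplication by [|exp (i * theta) - 1| ^ 2], which is at
    least [theta ^ 2 / 4] here; the product is at most 4. *)
Lemma fejer_decay L theta : `|theta| <= 2 -> theta ^+ 2 * fejer L theta <= 16.
Proof.
move=> t2; have tel : (2 - 2 * cos theta) * fejer L theta = 2 - 2 * cos (L%:R * theta).
  rewrite /fejer /exp_sum_sq.
  set c := \sum_(_ <- _) cos _; set d := \sum_(_ <- _) sin _.
  have h1 : (cos theta - 1) * c - sin theta * d = cos (L%:R * theta) - 1.
    rewrite /c /d; elim: (L) => [|n IH].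
      by rewrite !big_geq// !mulr0 mul0r cos0 !subrr.
    rewrite !big_nat_recr//= [X in _ = cos X - 1](_ : _ = n%:R * theta + theta); last first.
      by rewrite -natr1 mulrDl mul1r.
    rewrite cosD.
    by move: IH; set u := \big[_/_]_(_ <= _ < _) _; set v := \big[_/_]_(_ <= _ < _) _; lra.
  have h2 : sin theta * c + (cos theta - 1) * d = sin (L%:R * theta).
    rewrite /c /d; elim: (L) => [|n IH].
      by rewrite !big_geq// !mulr0 mul0r sin0 addr0.
    rewrite !big_nat_recr//= [X in _ = sin X](_ : _ = n%:R * theta + theta); last first.
      by rewrite -natr1 mulrDl mul1r.
    rewrite sinD.
    by move: IH; set u := \big[_/_]_(_ <= _ < _) _; set v := \big[_/_]_(_ <= _ < _) _; lra.
  have e1 := cos2Dsin2 theta; have e2 := cos2Dsin2 (L%:R * theta).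
  have : ((cos theta - 1) * c - sin theta * d) ^+ 2 + (sin theta * c + (cos theta - 1) * d) ^+ 2
      = (2 - 2 * cos theta) * (c ^+ 2 + d ^+ 2).
    have -> : 2 - 2 * cos theta = (cos theta - 1) ^+ 2 + sin theta ^+ 2.
      by rewrite sqrrB; lra.
    by ring.
  by move=> <-; rewrite h1 h2 sqrrB; lra.
have h := one_minus_cos_ge t2; have g0 := exp_sum_sq_ge0 (index_iota 0 L) (fun j => j%:R * theta).
have : theta ^+ 2 / 4 * fejer L theta <= (2 - 2 * cos theta) * fejer L theta.
  by rewrite ler_wpM2r//; lra.
rewrite tel => h1; have := cos_geN1 (L%:R * theta); lra.
Qed.

Lemma sum_shift (g : nat -> R) i n : \sum_(i <= k < i + n) g k = \sum_(0 <= k < n) g (k + i)%N.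
Proof. by rewrite -{1}[i]add0n big_addn addKn. Qed.

(** In truncated subtraction [(i - j) + (j - i)] is [|i - j|]. For every [i < L] the choices
    [j = i + k] realize all distances [k < L]. *)
Lemma sum_dist_ge (f : nat -> R) L : (forall k, 0 <= f k) ->
  L%:R * (\sum_(0 <= k < L) f k) <=
  \sum_(0 <= i < 2 * L) \sum_(0 <= j < 2 * L) f ((i - j) + (j - i))%N.
Proof.
move=> f0.
have s0 a b (g : nat -> R) : (forall k, 0 <= g k) -> 0 <= \sum_(a <= k < b) g k.
  by move=> g0; apply: sumr_ge0.
rewrite [X in _ <= X](@big_cat_nat _ _ _ L)//=; last by rewrite mul2n -addnn leq_addr.
apply: (@le_trans _ _ (\sum_(0 <= i < L) \sum_(0 <= k < L) f k)).
  by rewrite sumr_const_nat subn0 mulr_natl.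
apply: ler_wpDr; first by apply: (s0 _ _ _) => k; exact: s0.
rewrite [X in X <= _]big_nat [X in _ <= X]big_nat; apply: ler_sum => i /andP[_ iL].
rewrite [X in _ <= X](@big_cat_nat _ _ _ i)//=; last by lia.
rewrite [X in _ + X](@big_cat_nat _ _ _ (i + L)%N)//=; [|by rewrite leq_addr|by lia].
apply: ler_wpDl; first exact: s0.
apply: ler_wpDr; first exact: s0.
rewrite (sum_shift (fun j => f (i - j + (j - i))%N) i L) le_eqVlt; apply/orP; left; apply/eqP.
by apply: eq_bigr => k _; congr f; lia.
Qed.

(** For fixed [i] each distance occurs at most twice, once on either side. *)
Lemma sum_dist_le (f : nat -> R) L : (forall k, 0 <= f k) ->
  \sum_(0 <= i < L) \sum_(0 <= j < L) f ((i - j) + (j - i))%N <=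
  2 * L%:R * (\sum_(0 <= k < L) f k).
Proof.
move=> f0; set S := \sum_(0 <= k < L) f k.
have sub a b : (a <= b <= L)%N -> \sum_(a <= k < b) f k <= S.
  move=> /andP[ab bL]; rewrite /S [X in _ <= X](@big_cat_nat _ _ _ a)//=; last by lia.
  rewrite [X in _ + X](@big_cat_nat _ _ _ b)//=.
  by rewrite ler_wpDl ?sumr_ge0// ler_wpDr ?sumr_ge0.
apply: (@le_trans _ _ (\sum_(0 <= i < L) (2 * S))); last first.
  by rewrite sumr_const_nat subn0 -[X in X <= _]mulr_natl mulrA [L%:R * 2]mulrC.
rewrite [X in X <= _]big_nat [X in _ <= X]big_nat; apply: ler_sum => i /andP[_ iL].
rewrite (@big_cat_nat _ _ _ i)//=; last exact: ltnW.
rewrite [2 * S]mulr_natl mulr2n; apply: lerD.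
  rewrite big_nat_rev/= add0n.
  apply: le_trans (sub 1%N i.+1 _); last by lia.
  rewrite big_add1/= le_eqVlt; apply/orP; left; apply/eqP.
  rewrite big_nat [RHS]big_nat; apply: eq_bigr => k /andP[_ ki]; congr f; lia.
apply: le_trans (sub 0%N (L - i)%N _); last by lia.
rewrite -[in X in X <= _](subnKC (ltnW iL)) (sum_shift (fun j => f (i - j + (j - i))%N) i (L - i)) le_eqVlt; apply/orP; left; apply/eqP.
by apply: eq_bigr => k _; congr f; lia.
Qed.

(** Both sides expand to the same fourfold sum of [cos ((i - j) * (phi a - phi b))]. *)
Lemma sum_fejer (T : Type) (s : seq T) (phi : T -> R) L :
  \sum_(a <- s) \sum_(b <- s) fejer L (phi a - phi b) =
  \sum_(0 <= i < L) \sum_(0 <= j < L)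
    exp_sum_sq s (fun z => ((i - j) + (j - i))%:R * phi z).
Proof.
under eq_bigr do under eq_bigr do rewrite /fejer exp_sum_sqE.
under [RHS]eq_bigr do under eq_bigr do rewrite exp_sum_sqE.
under eq_bigr do rewrite exchange_big/=.
rewrite exchange_big/=; apply: eq_bigr => i _.
under eq_bigr do rewrite exchange_big/=.
rewrite exchange_big/=; apply: eq_bigr => j _.
apply: eq_bigr => a _; apply: eq_bigr => b _.
rewrite -!mulrBl -mulrBr; have [ij|/ltnW ij] := leqP i j.
  by rewrite (_ : (i - j)%N = 0%N) ?add0n; [rewrite -cosN -mulNr opprB natrB|lia].
by rewrite (_ : (j - i)%N = 0%N) ?addn0; [rewrite natrB|lia].
Qed.

(** Duality: the mean square over frequencies is controlled by the closeness of pairs of phases. *)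
Lemma sum_exp_sum_sq_le (T : Type) (s : seq T) (phi : T -> R) L :
  L%:R * (\sum_(0 <= k < L) exp_sum_sq s (fun z => k%:R * phi z)) <=
  \sum_(a <- s) \sum_(b <- s) fejer (2 * L) (phi a - phi b).
Proof.
rewrite sum_fejer; apply: (@sum_dist_ge (fun k => exp_sum_sq s (fun z => k%:R * phi z))).
by move=> k; exact: exp_sum_sq_ge0.
Qed.

(** The converse direction, used to count close pairs from a bound on the exponential sums. *)
Lemma sum_fejer_le (T : Type) (s : seq T) (phi : T -> R) L :
  \sum_(a <- s) \sum_(b <- s) fejer L (phi a - phi b) <=
  2 * L%:R * (\sum_(0 <= k < L) exp_sum_sq s (fun z => k%:R * phi z)).
Proof.
rewrite sum_fejer; apply: (@sum_dist_le (fun k => exp_sum_sq s (fun z => k%:R * phi z))).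
by move=> k; exact: exp_sum_sq_ge0.
Qed.

End trigonometric_sums.

(** * Prefixes and the large sieve *)

Section prefixes.
Context (R : realType).
Context (p q : nat).
Implicit Types (n m k u : nat) (x y z : R).

Let N := (24 * q + 1)%N.
Let M := (11 * q + 1)%N.

(** The numerators [k] for which the block set, translated by [k] and divided by [N ^ n], is a
    level-[n] cylinder. *)
Fixpoint prefixes n : seq nat :=
  if n is m.+1 then [seq (d * N ^ m + k)%N | d <- iota (p * q) M, k <- prefixes m]
  else [:: 0%N].

Lemma size_prefixes n : size (prefixes n) = (M ^ n)%N.
Proof. by elim: n => [//|n IH] /=; rewrite size_allpairs size_iota IH expnS. Qed.

Lemma prefixes_cat (f : nat -> R) m n :
  \sum_(x <- prefixes (m + n)) f x =
  \sum_(u <- prefixes m) \sum_(k <- prefixes n) f (u * N ^ n + k)%N.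
Proof.
elim: m f => [|m IH] f; first by rewrite big_seq1 /= ; apply: eq_bigr => k _; rewrite mul0n.
rewrite addSn /= !big_allpairs_dep/=; apply: eq_bigr => d _.
rewrite (IH (fun k => f (d * N ^ (m + n) + k)%N)); apply: eq_bigr => u _.
by apply: eq_bigr => k _; rewrite addnA expnD mulnA -mulnDl.
Qed.

Context (p13 : (p <= 13)%N).
Context (q0 : (0 < q)%N).

Lemma prefixes_lt n k : k \in prefixes n -> (k < N ^ n)%N.
Proof.
elim: n k => [|n IH] k /=; first by rewrite inE => /eqP ->.
case/allpairsP => -[d j] /= [+ /IH jn ->]; rewrite mem_iota => /andP[_ dM].
have dN : (d.+1 <= N)%N by rewrite /N; move: dM; rewrite /M; nia.
by rewrite expnS; have := leq_mul2r (N ^ n) d.+1 N; rewrite dN orbT; nia.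
Qed.

Lemma prefixes_uniq n : uniq (prefixes n).
Proof.
elim: n => [//|n IH] /=.
apply: allpairs_uniq => //; first exact: iota_uniq.
move=> [d j] [d' j'] /allpairsP[[a b] /= [_ bn [-> ->]]] /allpairsP[[a' b'] /= [_ bn' [-> ->]]].
have Nn : (0 < N ^ n)%N by rewrite expn_gt0 /N addn1.
have bl := prefixes_lt bn; have bl' := prefixes_lt bn'.
move=> h; have e : a = a'.
  by have := congr1 (fun v : nat => v %/ N ^ n)%N h; rewrite !divnMDl// !divn_small// !addn0.
by move: h; rewrite e => /addnI ->.
Qed.

Lemma prefixes_block_set n k x : k \in prefixes n -> block_set R p q x ->
  block_set R p q ((k%:R + x) / N%:R ^+ n).
Proof.
move=> kn Kx; elim: n k kn => [|n IH] k /=.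
  by rewrite inE => /eqP ->; rewrite add0r divr1.
case/allpairsP => -[d j] /= [+ /IH Kj ->]; rewrite mem_iota => dpq.
have N0 : (N%:R : R) != 0 by rewrite pnatr_eq0 /N addn1.
have -> : ((d * N ^ n + j)%:R + x) / N%:R ^+ n.+1 = (d%:R + (j%:R + x) / N%:R ^+ n) / N%:R.
  rewrite natrD natrM natrX exprS.
  by move: N0; set a : R := N%:R; move=> a0; clearbody a; field; rewrite a0 expf_neq0.
by apply: block_set_cons => //; move: dpq; rewrite /M; lia.
Qed.

Lemma count_near (s : seq nat) z (r : R) : uniq s -> 0 <= r ->
  (count (fun k => `|k%:R - z| <= r) s)%:R <= 2 * r + 1.
Proof.
move=> us r0; rewrite -size_filter; set t := seq.filter _ s.
have ut : uniq t by exact: filter_uniq.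
have tP k : k \in t -> `|k%:R - z| <= r by rewrite mem_filter => /andP[].
have [tE|[k0 k0t]] : t = [::] \/ exists k, k \in t.
  by case: (t) => [|a l]; [left|right; exists a; rewrite inE eqxx].
  by rewrite tE/=; lra.
have ex : exists k, k \in t by exists k0.
case: (ex_minnP ex) => m mt mmin.
have tsub : {subset t <= iota m (Num.truncn (2 * r)).+1}.
  move=> k kt; rewrite mem_iota mmin//= addnS ltnS -leq_subLR.
  rewrite truncn_ge_nat ?mulr_ge0// natrB ?mmin//.
  have := tP _ kt; have := tP _ mt; rewrite !ler_norml => /andP[? ?] /andP[? ?]; lra.
have := uniq_leq_size ut tsub; rewrite size_iota -(ler_nat R) => /le_trans; apply.
rewrite -natr1 lerD2r; have r2 : 0 <= 2 * r by lra.
by have /andP[] := truncn_itv r2.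
Qed.

Lemma count_prefixes_near n j z : (j <= n)%N ->
  (count (fun k => `|k%:R - z| <= N%:R ^+ (n - j)) (prefixes n))%:R <= 4 * M%:R ^+ (n - j) :> R.
Proof.
move=> jn; rewrite -{2}(subnKC jn) -sum1_count natr_sum big_mkcond /=.
set m := (n - j)%N.
rewrite (prefixes_cat (fun k => if `|k%:R - z| <= N%:R ^+ m then 1%:R else 0)).
have rho0 : 0 < N%:R ^+ m :> R by rewrite exprn_gt0// ltr0n /N addn1.
(* Only prefixes [u] whose interval of length [N ^ m] meets the window contribute. They lie within
   3/2 of a fixed point, so there are at most [2 * (3 / 2) + 1 = 4], each with [M ^ m]
   extensions. *)
apply: (@le_trans _ _ (\sum_(u <- prefixes j)
  (if `|u%:R - (z / N%:R ^+ m - 1 / 2)| <= 3 / 2 then M%:R ^+ m else 0 : R))).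
  apply: ler_sum => u _; case: ifP => [_|/negbT far].
    apply: (@le_trans _ _ (\sum_(k <- prefixes m) (1 : R))).
      by apply: ler_sum => k _; case: ifP.
    by rewrite sum_const_seq size_prefixes mulr1 natrX.
  rewrite big_seq big1// => k km; case: ifP => // near; case/negP: far.
  have kN : k%:R <= N%:R ^+ m :> R by rewrite -natrX ler_nat ltnW// prefixes_lt.
  have k0 := ler0n R k; move: near; rewrite natrD natrM natrX.
  set rho : R := N%:R ^+ m in kN rho0 *.
  have -> : u%:R - (z / rho - 1 / 2) = (u%:R * rho - z + rho / 2) / rho.
    by field; rewrite gt_eqF.
  rewrite [`|_ / rho|]normrM [`|rho^-1|]gtr0_norm ?invr_gt0// ler_pdivrMr//.
  by rewrite !ler_norml => /andP[? ?]; apply/andP; split; lra.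
rewrite -big_mkcond/= -[X in X <= _]mulr1 -big_filter sum_const_seq size_filter mulr1.
rewrite ler_wpM2r ?exprn_ge0//.
apply: le_trans (count_near _ (prefixes_uniq j) _) _; lra.
Qed.

(** An [N]-adic decomposition by distance to [z]. Induction on [J] splits off the points near [z],
    where the uniform bound is used; on the others the quadratic decay gives the uniform bound of
    the previous scale. *)
Lemma energy_bound n J z (g : nat -> R) : (J <= n)%N ->
  (forall k, 0 <= g k <= N%:R ^+ (2 * J)) ->
  (forall k, k \in prefixes n -> g k * (k%:R - z) ^+ 2 <= N%:R ^+ (2 * n)) ->
  \sum_(k <- prefixes n) g k <= 4 * N%:R ^+ (2 + 2 * J) * M%:R ^+ (n - J).
Proof.
have N1 : 1 <= N%:R :> R by rewrite ler1n /N addn1.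
have N0 : 0 < N%:R :> R by apply: lt_le_trans N1.
have M0 : 0 <= M%:R :> R by [].
elim: J g => [|J IH] g Jn g0 gz.
  apply: (@le_trans _ _ (\sum_(k <- prefixes n) (1 : R))).
    by apply: ler_sum => k _; case/andP: (g0 k); rewrite muln0 expr0.
  rewrite sum_const_seq size_prefixes mulr1 subn0 natrX ler_peMl ?exprn_ge0//.
  have : 1 <= N%:R ^+ (2 + 2 * 0) :> R by rewrite exprn_ege1.
  lra.
pose near k := `|k%:R - z| <= N%:R ^+ (n - J) :> R.
rewrite (bigID near)/=.
have split_near : \sum_(k <- prefixes n | near k) g k <= 4 * M%:R ^+ (n - J) * N%:R ^+ (2 * J.+1).
  apply: (@le_trans _ _ (\sum_(k <- prefixes n | near k) N%:R ^+ (2 * J.+1))).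
    by apply: ler_sum => k _; case/andP: (g0 k).
  rewrite -big_filter sum_const_seq size_filter ler_wpM2r ?exprn_ge0 ?(ltW N0)//.
  by apply: count_prefixes_near; exact: ltnW.
have split_far : \sum_(k <- prefixes n | ~~ near k) g k <=
    4 * N%:R ^+ (2 + 2 * J) * M%:R ^+ (n - J).
  rewrite big_mkcond/= big_seq.
  (* Setting [g] to 0 at the near points makes the induction hypothesis applicable. *)
  pose g' k := if (k \in prefixes n) && ~~ near k then g k else 0.
  rewrite (eq_bigr g'); last by move=> k kn; rewrite /g' kn.
  rewrite -big_seq; apply: IH; first exact: ltnW.
    move=> k; rewrite /g'; case: ifP => [/andP[kn fark]|_]; last first.
      by rewrite lexx exprn_ge0// ltW.
    case/andP: (g0 k) => -> _ /=.
    move: fark; rewrite /near -ltNge => fark.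
    have fark2 : N%:R ^+ (2 * (n - J)) <= (k%:R - z) ^+ 2.
      rewrite mulnC exprM -(real_normK (num_real (k%:R - z))).
      by apply: lerXn2r; rewrite ?nnegrE ?exprn_ge0 ?(ltW N0) ?(ltW fark).
    have P0 : 0 < N%:R ^+ (2 * (n - J)) :> R by rewrite exprn_gt0.
    rewrite -(ler_pM2r P0) -exprD -mulnDr subnKC; last exact: ltnW.
    apply: le_trans (gz k kn); rewrite ler_wpM2l//.
    by case/andP: (g0 k).
  move=> k kn; rewrite /g'; case: ifP => [_|_]; first exact: gz.
  by rewrite mul0r exprn_ge0// ltW.
apply: (le_trans (lerD split_near split_far)).
have -> : (n - J = (n - J.+1).+1)%N by lia.
have -> : (2 + 2 * J.+1 = 2 + 2 * J + 2)%N by lia.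
have -> : (2 * J.+1 = 2 + 2 * J)%N by lia.
(* The two contributions are equal, and [2 * M <= N ^ 2] absorbs their sum into the next scale. *)
rewrite exprS [N%:R ^+ (_ + 2)]exprD.
have MN : 2 * M%:R <= N%:R ^+ 2 :> R.
  by rewrite -natrM -natrX ler_nat /M /N; nia.
set a := N%:R ^+ (2 + _); set b := M%:R ^+ _.
have ab : 0 <= a * b by rewrite mulr_ge0 ?exprn_ge0// ltW.
have -> : 4 * (M%:R * b) * a + 4 * a * (M%:R * b) = 4 * (a * b) * (2 * M%:R) by ring.
have -> : 4 * (a * N%:R ^+ 2) * b = 4 * (a * b) * N%:R ^+ 2 by ring.
by rewrite ler_wpM2l// mulr_ge0.
Qed.

(** Duality reduces the mean square to Fejer kernels summed over pairs; the separation of the phases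
    makes the kernel decay quadratically in [k - m], and [energy_bound] sums it. *)
Lemma large_sieve n J L (sigma : R) (t : nat -> R) : (J <= n)%N -> (0 < L)%N -> 0 < sigma ->
  (forall k m, k \in prefixes n -> m \in prefixes n -> `|t k - t m| <= 2) ->
  (forall k m, k \in prefixes n -> m \in prefixes n ->
     sigma * `|k%:R - m%:R| <= `|t k - t m| * N%:R ^+ n) ->
  N%:R ^+ J <= sigma * L%:R ->
  (\sum_(0 <= k < L) exp_sum_sq (prefixes n) (fun m => k%:R * t m)) * M%:R ^+ J <=
    64 * N%:R ^+ 2 * L%:R * M%:R ^+ (2 * n).
Proof.
move=> Jn L0 sigma0 t2 tsep NJ.
have L0' : 0 < L%:R :> R by rewrite ltr0n.
have N0 : 0 < N%:R :> R by rewrite ltr0n /N addn1.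
have M0 : 0 < M%:R :> R by rewrite ltr0n /M addn1.
have NJ0 : 0 < N%:R ^+ J :> R by rewrite exprn_gt0.
have inner m : m \in prefixes n -> \sum_(k <- prefixes n) fejer (2 * L) (t k - t m) <=
    64 * N%:R ^+ 2 * L%:R ^+ 2 * M%:R ^+ (n - J).
  move=> mn.
  (* This factor turns the kernel bounds [(2 * L) ^ 2] and [16 / theta ^ 2] into the two hypotheses
     of [energy_bound]; the second uses [N ^ J <= sigma * L]. *)
  pose c : R := N%:R ^+ (2 * J) / (16 * L%:R ^+ 2).
  have c0 : 0 < c by rewrite divr_gt0 ?mulr_gt0 ?exprn_gt0.
  have := @energy_bound n J m%:R (fun k => c * fejer (2 * L) (t k - t m)) Jn.
  rewrite -big_distrr/= => h.
  have {h} : c * \sum_(k <- prefixes n) fejer (2 * L) (t k - t m) <=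
      4 * N%:R ^+ (2 + 2 * J) * M%:R ^+ (n - J).
    apply: h => [k|k kn].
      rewrite mulr_ge0 ?(ltW c0) ?exp_sum_sq_ge0//=.
      have := fejer_le (2 * L) (t k - t m); rewrite -(ler_pM2l c0) => /le_trans; apply.
      have -> : c * (2 * L)%:R ^+ 2 = N%:R ^+ (2 * J) / 4.
        by rewrite /c natrM; field; rewrite gt_eqF.
      have : 0 <= N%:R ^+ (2 * J) :> R by rewrite exprn_ge0// ltW.
      lra.
    have sep := tsep k m kn mn; have fd := fejer_decay (2 * L) (t2 k m kn mn).
    set f := fejer _ _ in fd *; have f0 : 0 <= f by exact: exp_sum_sq_ge0.
    have sep2 : sigma ^+ 2 * (k%:R - m%:R) ^+ 2 <= (t k - t m) ^+ 2 * N%:R ^+ (2 * n).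
      rewrite -(real_normK (num_real (k%:R - m%:R))) -(real_normK (num_real (t k - t m))).
      rewrite mulnC exprM -!exprMn lerXn2r// nnegrE ?mulr_ge0 ?exprn_ge0// ltW//.
    have NJ2 : N%:R ^+ (2 * J) <= sigma ^+ 2 * L%:R ^+ 2.
      by rewrite mulnC exprM -exprMn lerXn2r// nnegrE ?mulr_ge0 ?exprn_ge0// ltW.
    have NJsig : c <= sigma ^+ 2 / 16.
      rewrite /c ler_pdivrMr ?mulr_gt0 ?exprn_gt0//.
      by have -> : sigma ^+ 2 / 16 * (16 * L%:R ^+ 2) = sigma ^+ 2 * L%:R ^+ 2 by field.
    have k2 : 0 <= (k%:R - m%:R) ^+ 2 :> R by rewrite sqr_ge0.
    have Nn : 0 <= N%:R ^+ (2 * n) :> R by rewrite exprn_ge0// ltW.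
    apply: (@le_trans _ _ (sigma ^+ 2 / 16 * f * (k%:R - m%:R) ^+ 2)).
      by rewrite ler_wpM2r// ler_wpM2r.
    apply: (@le_trans _ _ ((t k - t m) ^+ 2 * f * N%:R ^+ (2 * n) / 16)).
      by have := ler_wpM2l f0 sep2; lra.
    by have := ler_wpM2r Nn fd; lra.
  rewrite -ler_pdivlMl// => /le_trans; apply; rewrite le_eqVlt; apply/orP; left; apply/eqP.
  have -> : N%:R ^+ (2 + 2 * J) = N%:R ^+ 2 * N%:R ^+ (2 * J) :> R by rewrite exprD.
  rewrite /c; have : N%:R ^+ (2 * J) != 0 :> R by rewrite gt_eqF// exprn_gt0.
  by set a : R := N%:R ^+ (2 * J) => a0; field; rewrite a0 gt_eqF.
have outer := sum_exp_sum_sq_le (prefixes n) t L.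
have {outer} : L%:R * (\sum_(0 <= k < L) exp_sum_sq (prefixes n) (fun m => k%:R * t m)) <=
    M%:R ^+ n * (64 * N%:R ^+ 2 * L%:R ^+ 2 * M%:R ^+ (n - J)).
  apply: (le_trans outer); rewrite exchange_big/= big_seq.
  apply: (le_trans (ler_sum _ (fun m mn => inner m mn))).
  by rewrite -big_seq sum_const_seq size_prefixes natrX.
set S := \sum_(0 <= k < L) _ => h.
have -> : (2 * n = n + (n - J) + J)%N by lia.
rewrite 2!exprD mulrA ler_pM2r ?exprn_gt0//.
rewrite -(ler_pM2l L0'); apply: (le_trans h).
by rewrite le_eqVlt; apply/orP; left; apply/eqP; ring.
Qed.

End prefixes.

(** * Decay of the exponential sums over E *)

Section decay.
Context (R : realType).
Implicit Types (k l m n u : nat).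

(** The lower bound comes from [ln (1 + w) <= w] at [1 + w = 1 / (1 + z)]. *)
Lemma ln1D_bound (z : R) : 0 <= z -> z - z ^+ 2 <= ln (1 + z) <= z.
Proof.
move=> z0; have z1 : 0 < 1 + z by lra.
apply/andP; split; last by apply: le_ln1Dx; lra.
have : ln (1 + - (z / (1 + z))) <= - (z / (1 + z)).
  apply: le_ln1Dx; rewrite ltrN2 ltr_pdivrMr//; lra.
have -> : 1 + - (z / (1 + z)) = (1 + z)^-1 by field; rewrite gt_eqF.
rewrite lnV ?posrE// lerN2 => /(le_trans _); apply.
rewrite -subr_ge0; have -> : z / (1 + z) - (z - z ^+ 2) = z ^+ 3 / (1 + z).
  by field; rewrite gt_eqF.
by rewrite divr_ge0 ?exprn_ge0// ltW.
Qed.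

Lemma sum_uniq_sub_le (s r : seq nat) (g : nat -> R) : uniq s -> uniq r ->
  {subset s <= r} -> (forall k, 0 <= g k) -> \sum_(k <- s) g k <= \sum_(k <- r) g k.
Proof.
move=> us ur sr g0; rewrite [X in _ <= X](bigID (mem s))/=.
have ps : perm_eq [seq k <- r | k \in s] s.
  apply: uniq_perm => //; first exact: filter_uniq.
  move=> k; rewrite mem_filter.
  by apply/andP/idP => [[]//|ks]; split=> //; exact: sr.
by rewrite -[X in X + _]big_filter (perm_big _ ps)/= lerDl sumr_ge0.
Qed.

(** Cauchy-Schwarz over the [M ^ m] prefixes of length [m]. *)
Lemma exp_sum_sq_prefixes_cat p q m l (phi : nat -> R) :
  exp_sum_sq (prefixes p q (m + l)) phi <= (11 * q + 1)%:R ^+ m *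
    \sum_(u <- prefixes p q m) exp_sum_sq (prefixes p q l)
      (fun k => phi (u * (24 * q + 1) ^ l + k)%N).
Proof.
rewrite /exp_sum_sq big_split/= mulrDr !prefixes_cat -natrX -(size_prefixes p q m).
by apply: lerD; exact: sum_sqr_le.
Qed.

(* The phase [k / 2 * ln x] is linearized around the prefix [u] of length [m];
   the slopes become multiples of [k / 2 * N ^- (2 * m)] by distinct integers
   [N ^ (2 * m) %/ u], so that the large sieve applies to the sum over [u]. *)
Lemma log_exp_sum_decay q m l J k : (0 < q)%N -> (0 < m)%N -> (J <= l)%N ->
  let N : R := (24 * q + 1)%:R in let M : R := (11 * q + 1)%:R in
  let tau : R := k%:R / 2 / N ^+ (2 * m) in
  0 < tau <= 2 -> N ^+ J <= tau * (2 * N ^+ m) ->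
  exp_sum_sq (prefixes 13 q (m + l)) (fun x => k%:R * (ln (x%:R + 1) / 2)) <=
   M ^+ m * (2 * (64 * N ^+ 2 * (2 * N ^+ m) * M ^+ (2 * l) / M ^+ J) +
             M ^+ m * (4 * (M ^+ l * (5 * tau)) ^+ 2)).
Proof.
move=> q0 m0 Jl N M tau /andP[tau0 tau2] NJ.
have N25 : 25 <= N by rewrite /N ler_nat; lia.
have N0 : 0 < N by lra.
have Nm0 : 0 < N ^+ m by rewrite exprn_gt0.
have Nl0 : 0 < N ^+ l by rewrite exprn_gt0.
have M0 : 0 < M by rewrite /M ltr0n addn1.
have Nm25 : 25 <= N ^+ m.
  case: (m) m0 => // m' _; rewrite exprS (le_trans N25)// ler_peMr ?(ltW N0)//.
  by rewrite exprn_ege1//; lra.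
have p13 : (13 <= 13)%N by [].
(* The hull gives [u + 13 / 24 >= 13 / 24 * N ^ m], and [N ^ m >= 25] leaves room for the summand on
   the left. *)
have uge u : u \in prefixes 13 q m -> N ^+ m / 2 < u%:R.
  move=> um.
  have K13 : block_set R 13 q (13%:R / 24) by exact: block_set_const.
  have /(block_set_bound q0)/andP[h _] := prefixes_block_set p13 q0 um K13.
  rewrite ler_pdivlMr// -/N in h; lra.
have ule u : u \in prefixes 13 q m -> (u < (24 * q + 1) ^ m)%N by exact: prefixes_lt.
apply: (le_trans (exp_sum_sq_prefixes_cat _ _ _ _ _)).
rewrite -/M ler_wpM2l ?exprn_ge0 ?(ltW M0)//.
pose e (x : nat) : R := (x%:R + 1) / N ^+ l.
(* The slope [N ^ (2 * m) / u] rounded to an integer, which becomes the frequency in the large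
   sieve. *)
pose lu u := ((24 * q + 1) ^ (2 * m) %/ u)%N.
have e01 x : x \in prefixes 13 q l -> 0 < e x <= 1.
  move=> /(prefixes_lt p13 q0) xl; rewrite divr_gt0 ?ltr_wpDl//= ler_pdivrMr// mul1r.
  by rewrite natr1 -natrX ler_nat.
have lin u : u \in prefixes 13 q m ->
    exp_sum_sq (prefixes 13 q l)
      (fun x => k%:R * (ln ((u * (24 * q + 1) ^ l + x)%:R + 1) / 2)) <=
    2 * exp_sum_sq (prefixes 13 q l) (fun x => (lu u)%:R * (tau * e x)) +
    4 * (M ^+ l * (5 * tau)) ^+ 2.
  move=> um; have ug := uge u um; have u0 : 0 < u%:R :> R by lra.
  (* A constant phase is free: subtracting the value at the prefix leaves only
     [ln (1 + e x / u)]. *)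
  rewrite -(exp_sum_sq_shift _ _ (- (k%:R * (ln (u%:R * N ^+ l) / 2)))).
  (* The error [5 * tau] allows [4 * tau] for the quadratic term of the logarithm and [tau] for
     rounding the slope. *)
  have := @exp_sum_sq_lipschitz R _ (prefixes 13 q l)
    (fun x => - (k%:R * (ln (u%:R * N ^+ l) / 2)) +
       k%:R * (ln ((u * (24 * q + 1) ^ l + x)%:R + 1) / 2))
    (fun x => (lu u)%:R * (tau * e x)) (5 * tau).
  rewrite size_prefixes natrX; apply => x xl.
  have /andP[e0 e1] := e01 x xl.
  have -> : (u * (24 * q + 1) ^ l + x)%:R + 1 = u%:R * N ^+ l * (1 + e x / u%:R) :> R.
    by rewrite natrD natrM natrX -/N /e; field; rewrite !gt_eqF.
  have z0 : 0 < e x / u%:R by rewrite divr_gt0.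
  have z1 : 0 < 1 + e x / u%:R by lra.
  rewrite [ln (_ * (1 + _))]lnM ?posrE ?mulr_gt0//.
  have -> : - (k%:R * (ln (u%:R * N ^+ l) / 2)) +
      k%:R * ((ln (u%:R * N ^+ l) + ln (1 + e x / u%:R)) / 2) =
      tau * N ^+ (2 * m) * ln (1 + e x / u%:R).
    by rewrite /tau; field; rewrite gt_eqF ?exprn_gt0.
  have /andP[l1 l2] := ln1D_bound (ltW z0).
  set z := e x / u%:R in z0 l1 l2 *; set w := ln (1 + z) in l1 l2 *.
  have N2m : 0 < N ^+ (2 * m) by rewrite exprn_gt0.
  have zle : N ^+ (2 * m) * z ^+ 2 <= 4.
    have zN : N ^+ m * z <= 2.
      rewrite /z mulrA ler_pdivrMr//; have := ler_wpM2l (ltW Nm0) e1; lra.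
    have zN0 : 0 <= N ^+ m * z by exact: mulr_ge0 (ltW Nm0) (ltW z0).
    by rewrite mulnC exprM -exprMn expr2; nra.
  have /andP[f1 f2] : (lu u)%:R <= N ^+ (2 * m) / u%:R <= (lu u)%:R + 1.
    rewrite ler_pdivlMr// ler_pdivrMr// natr1 -natrX -!natrM !ler_nat.
    have uN : (0 < u)%N by rewrite -(ltr_nat R).
    by rewrite leq_divM/= ltnW// ltn_ceil.
  have z2 : N ^+ (2 * m) * z = N ^+ (2 * m) / u%:R * e x.
    by rewrite /z; field; rewrite gt_eqF.
  have g1 : N ^+ (2 * m) * z - 4 <= N ^+ (2 * m) * w by have := ler_wpM2l (ltW N2m) l1; lra.
  have g2 : N ^+ (2 * m) * w <= N ^+ (2 * m) * z by rewrite ler_wpM2l// ltW.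
  have g3 : (lu u)%:R * e x <= N ^+ (2 * m) * z by rewrite z2 ler_wpM2r// ltW.
  have g4 : N ^+ (2 * m) * z <= (lu u)%:R * e x + 1.
    by rewrite z2; have := ler_wpM2r (ltW e0) f2; lra.
  have -> : tau * N ^+ (2 * m) * w - (lu u)%:R * (tau * e x) =
    tau * (N ^+ (2 * m) * w - (lu u)%:R * e x) by ring.
  rewrite normrM (gtr0_norm tau0) [5 * tau]mulrC ler_pM2l// ler_norml.
  by apply/andP; split; lra.
rewrite big_seq; apply: (le_trans (ler_sum _ lin)).
rewrite -big_seq big_split/= sum_const_seq size_prefixes natrX -/M lerD2r.
rewrite -big_distrr/= ler_pM2l//.
rewrite -(big_map lu xpredT (fun j => exp_sum_sq (prefixes 13 q l) (fun x => j%:R * (tau * e x)))).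
(* The slopes are distinct and below [2 * N ^ m], so the sum may be extended to all frequencies in
   that range. *)
apply: (@le_trans _ _ (\sum_(0 <= j < 2 * (24 * q + 1) ^ m)
    exp_sum_sq (prefixes 13 q l) (fun x => j%:R * (tau * e x)))).
  apply: sum_uniq_sub_le; last by move=> j; exact: exp_sum_sq_ge0.
  - rewrite map_inj_in_uniq; first exact: prefixes_uniq.
    (* Since [v < N ^ m], the quotient [N ^ (2 * m) %/ v] is at least [v], so passing from [v] to a
       smaller [u] raises it by at least 1. *)
    have key u v : u \in prefixes 13 q m -> v \in prefixes 13 q m -> (u < v)%N -> (lu v < lu u)%N.
      move=> um vm uv; have ul := ule _ um; have vl := ule _ vm.
      have u0 : (0 < u)%N by rewrite -(ltr_nat R); have := uge _ um; lra.
      have v0 : (0 < v)%N by apply: leq_trans uv.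
      rewrite /lu leq_divRL//.
      set X := ((24 * q + 1) ^ (2 * m))%N.
      have h1 : (X %/ v * v <= X)%N by exact: leq_divM.
      have h2 : ((24 * q + 1) ^ m <= X %/ v)%N.
        by rewrite leq_divRL// /X mul2n -addnn expnD leq_mul2l ltnW ?orbT.
      have h3 : (v <= X %/ v)%N by apply: leq_trans h2; exact: ltnW.
      apply: leq_trans h1; set Y := (X %/ v)%N in h3 *.
      apply: (@leq_trans (Y * u.+1)); last by rewrite leq_mul2l uv orbT.
      by rewrite mulSn mulnS leq_add2r (leq_trans (ltnW uv)).
    move=> u v um vm luv; have [uv|vu|//] := ltngtP u v.
      by have := key _ _ um vm uv; rewrite luv ltnn.
    by have := key _ _ vm um vu; rewrite luv ltnn.
  - exact: iota_uniq.
  - move=> _ /mapP[u um ->]; rewrite mem_index_iota/=.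
    have u0 : (0 < u)%N by rewrite -(ltr_nat R); have := uge _ um; lra.
    rewrite /lu ltn_divLR// [X in (_ ^ X < _)%N]mul2n -addnn expnD -mulnA mulnCA ltn_pmul2l; last first.
      by rewrite expn_gt0 addn1.
    rewrite -(ltr_nat R) natrM natrX -/N; have := uge _ um; lra.
have := @large_sieve R 13 q p13 q0 l J (2 * (24 * q + 1) ^ m) tau (fun x => tau * e x) Jl.
rewrite natrM natrX -/N -/M -ler_pdivlMr ?exprn_gt0//; apply => //.
- by rewrite muln_gt0 expn_gt0 addn1.
- move=> x y xl yl; rewrite -mulrBr normrM (gtr0_norm tau0).
  have /andP[? ?] := e01 x xl; have /andP[? ?] := e01 y yl.
  apply: (le_trans _ tau2); rewrite ler_piMr ?(ltW tau0)// ler_norml.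
  by apply/andP; split; lra.
- move=> x y _ _; rewrite -mulrBr /e -mulrBl opprD addrACA subrr addr0.
  by rewrite normrM (gtr0_norm tau0) normrM normfV (gtr0_norm Nl0) mulrA divfK ?gt_eqF.
Qed.

End decay.

(** * Number of cells meeting the quotient *)

Section energy.
Context (R : realType).
Implicit Types (a b B : R) (k l m n L J : nat).

Lemma ln_sub_le a b : 0 < a -> 0 < b -> ln a - ln b <= (a - b) / b.
Proof.
move=> a0 b0; rewrite -ln_div ?posrE//.
have -> : a / b = 1 + (a - b) / b by field; rewrite gt_eqF.
apply: le_ln1Dx; rewrite ltr_pdivlMr//; lra.
Qed.

Lemma ln_dist_le a b c : 0 < c -> c <= a -> c <= b -> `|ln a - ln b| <= `|a - b| / c.
Proof.
move=> c0 ca cb; have a0 : 0 < a by lra.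
have b0 : 0 < b by lra.
have key (x y : R) : 0 < x -> 0 < y -> c <= y -> ln x - ln y <= `|x - y| / c.
  move=> x0 y0 cy; apply: (le_trans (ln_sub_le x0 y0)).
  apply: (@le_trans _ _ (`|x - y| / y)); first by rewrite ler_wpM2r ?invr_ge0 ?(ltW y0)// ler_norm.
  by rewrite ler_wpM2l// lef_pV2.
rewrite ler_norml; apply/andP; split; last exact: key.
by have := key b a b0 a0 ca; rewrite distrC; lra.
Qed.

Lemma ln_dist_ge a b B : 0 < a <= B -> 0 < b <= B -> `|a - b| <= `|ln a - ln b| * B.
Proof.
move=> /andP[a0 aB] /andP[b0 bB]; have B0 : 0 < B by lra.
have key (x y : R) : 0 < x -> 0 < y -> x <= B -> y <= x -> x - y <= `|ln x - ln y| * B.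
  move=> x0 y0 xB yx.
  have := ln_sub_le y0 x0.
  have -> : (y - x) / x = - ((x - y) / x) by field; rewrite gt_eqF.
  rewrite -opprB lerN2 => h; have {}h := le_trans h (ler_norm _).
  move: h; rewrite ler_pdivrMr// => /le_trans; apply.
  by rewrite ler_wpM2l.
have [ba|/ltW ab] := leP b a.
  by rewrite ger0_norm ?subr_ge0//; exact: key.
by rewrite distrC [`|ln a - _|]distrC ger0_norm ?subr_ge0//; exact: key.
Qed.

(** 12 is the ratio of the end points of the hull of F_1, and [ln 12 <= ln 16 <= 4]. *)
Lemma ln_dist_le4 a b : 0 < a -> 0 < b -> a <= 12 * b -> b <= 12 * a ->
  `|ln a - ln b| <= 4.
Proof.
move=> a0 b0 ab ba.
have key (x y : R) : 0 < x -> 0 < y -> x <= 12 * y -> ln x - ln y <= 4.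
  move=> x0 y0 xy; rewrite -ln_div ?posrE//.
  have l2 : ln 2 <= 1 :> R by have := @le_ln1Dx R 1; rewrite -[2]/(1 + 1); apply; lra.
  have : ln (x / y) <= ln (2 ^+ 4).
    rewrite ler_ln ?posrE ?divr_gt0 ?exprn_gt0// ler_pdivrMr//; lra.
  by rewrite lnXn//; lra.
rewrite ler_norml; apply/andP; split; last exact: key.
by have := key b a b0 a0 ba; lra.
Qed.

(** E_1 has base 25 and F_1 base 49. In the phases, the shifts 1 and 1/2 are the largest tails of
    the two sets; halving the logarithm keeps phase differences over F_1 at most 2. *)
Let PE l := prefixes 13 1 l.
Let PF l := prefixes 1 2 l.
Let tE (x : nat) : R := ln (x%:R + 1) / 2.
Let tF (y : nat) : R := ln (y%:R + 1 / 2) / 2.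

Lemma prefix_point_E l x : x \in PE l -> block_set R 13 1 ((x%:R + 1) / 25 ^+ l).
Proof.
move=> xl; have one : 1 = 24%:R / 24 :> R by rewrite divff.
have K1 : block_set R 13 1 1 by rewrite one; exact: block_set_const.
exact: (@prefixes_block_set R 13 1 (leqnn 13) isT l x 1 xl K1).
Qed.

Lemma prefix_point_F l y : y \in PF l -> block_set R 1 2 ((y%:R + 1 / 2) / 49 ^+ l).
Proof.
move=> yl; have half : 1 / 2 = 12%:R / 24 :> R by field.
have K1 : block_set R 1 2 (1 / 2) by rewrite half; exact: block_set_const.
exact: (@prefixes_block_set R 1 2 isT isT l y (1 / 2) yl K1).
Qed.

(** The large sieve with [sigma = 1]: on the hull [1/24, 1/2] half the logarithm has derivative at
    least 1. *)
Lemma mean_square_F l J L : (J <= l)%N -> (0 < L)%N -> 49 ^+ J <= L%:R :> R ->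
  \sum_(0 <= k < L) exp_sum_sq (PF l) (fun y => k%:R * tF y) <=
  64 * 49 ^+ 2 * L%:R * 23 ^+ (2 * l) / 23 ^+ J.
Proof.
move=> Jl L0 NJ; rewrite ler_pdivlMr ?exprn_gt0//.
have N0 : 0 < 49 ^+ l :> R by rewrite exprn_gt0.
have bd (y : nat) : y \in PF l -> 49 ^+ l / 24 <= (y%:R + 1 / 2 : R) <= 49 ^+ l / 2.
  move=> yl; have /andP[h1 h2] := block_set_bound (isT : 0 < 2)%N (prefix_point_F yl).
  rewrite ler_pdivlMr// in h1; rewrite ler_pdivrMr// in h2.
  by apply/andP; split; lra.
have y0 (y : nat) : 0 < y%:R + 1 / 2 :> R by have := ler0n R y; lra.
apply: (@large_sieve R 1 2 isT isT l J L 1 tF Jl L0 ltr01).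
- move=> k m /bd/andP[k1 k2] /bd/andP[m1 m2]; rewrite /tF -mulrBl normrM [`|2^-1|]ger0_norm//.
  by rewrite ler_pdivrMr//; apply: (@le_trans _ _ 4); [apply: ln_dist_le4 => //; lra|lra].
- move=> k m /bd/andP[k1 k2] /bd/andP[m1 m2]; rewrite mul1r /tF -mulrBl normrM [`|2^-1|]ger0_norm//.
  have := @ln_dist_ge (k%:R + 1 / 2) (m%:R + 1 / 2) (49 ^+ l / 2).
  rewrite !y0 opprD addrACA subrr addr0 => /(_ k2 m2) /le_trans; apply.
  by rewrite le_eqVlt; apply/orP; left; apply/eqP; rewrite -[(24 * 2 + 1)%N]/49%N; ring.
- by rewrite mul1r.
Qed.

(** For [k ~ 25 ^ (23 * n)] and prefixes of length [13 * n], the slope factor [tau] has order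
    [25 ^ (- 3 * n)]. The large sieve term gives the first power, the error [tau ^ 2] the second. *)
Lemma decay_E : exists2 C : R, 0 < C & forall n l k, (8 <= n)%N -> (23 * n <= l)%N ->
  25 ^+ (23 * n) <= k%:R :> R -> k%:R <= 25 ^+ (23 * n.+1) :> R ->
  exp_sum_sq (PE l) (fun x => k%:R * tE x) <=
  12 ^+ (2 * l) * C * ((25 ^+ 13 / 12 ^+ 23) ^+ n + (25 ^+ 6)^-1 ^+ n).
Proof.
exists (25 ^+ 48) => // n l k n8 nl k1 k2.
(* [J = 10 * n] fits because [k / 25 ^ m >= 25 ^ (23 * n - 13 * n)]. *)
pose m := (13 * n)%N; pose l' := (l - m)%N; pose J := (10 * n)%N.
have lE : l = (m + l')%N by rewrite /l' /m; lia.
have Jl : (J <= l')%N by rewrite /J /l' /m; lia.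
have m0 : (0 < m)%N by rewrite /m; lia.
pose tau : R := k%:R / 2 / 25 ^+ (2 * m).
have P0 j : 0 < 25 ^+ j :> R by rewrite exprn_gt0.
have k0 : 0 < k%:R :> R by apply: lt_le_trans k1.
have tau0 : 0 < tau by rewrite !divr_gt0.
have tau3 : tau <= 25 ^+ 23 / 2 / 25 ^+ (3 * n).
  have e : (2 * m = 23 * n + 3 * n)%N by rewrite /m; lia.
  have X0 := P0 (23 * n)%N; have Z0 := P0 (3 * n)%N.
  rewrite /tau e exprD; move: k2; rewrite mulnS exprD.
  move: X0 Z0; set X := 25 ^+ (23 * n); set Y := 25 ^+ 23; set Z := 25 ^+ (3 * n) => X0 Z0 h.
  rewrite ler_pdivrMr ?mulr_gt0//.
  have -> : Y / 2 / Z * (X * Z) = Y * X / 2 by field; rewrite gt_eqF.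
  lra.
(* Here [n >= 8] enters, through [3 * n >= 24]. *)
have tau2 : tau <= 2.
  apply: (le_trans tau3); rewrite ler_pdivrMr//.
  have : 25 ^+ 24 <= 25 ^+ (3 * n) :> R by rewrite ler_eXn2l//; [lia|lra].
  rewrite [25 ^+ 24]exprS; set X := 25 ^+ 23; set Y := 25 ^+ (3 * n).
  have : 0 < X by exact: P0.
  lra.
have := @log_exp_sum_decay R 1 m l' J k isT m0 Jl.
rewrite -[(24 * 1 + 1)%N]/25%N -[(11 * 1 + 1)%N]/12%N -/tau -lE => /(_ _ _) h.
have {h} := h ltac:(by rewrite tau0 tau2) _.
have NJ : 25 ^+ J <= tau * (2 * 25 ^+ m) :> R.
  have -> : tau * (2 * 25 ^+ m) = k%:R / 25 ^+ m.
    rewrite /tau mul2n -addnn exprD; have := gt_eqF (P0 m); set X := 25 ^+ m => X0.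
    by field; rewrite X0.
  rewrite ler_pdivlMr// -exprD; apply: le_trans k1.
  by rewrite le_eqVlt; apply/orP; left; apply/eqP; congr (_ ^+ _); rewrite /J /m; lia.
move=> /(_ NJ) /le_trans; apply.
have Q0 j : 0 < 12 ^+ j :> R by rewrite exprn_gt0.
have -> : 12 ^+ m * (2 * (64 * 25 ^+ 2 * (2 * 25 ^+ m) * 12 ^+ (2 * l') / 12 ^+ J) +
    12 ^+ m * (4 * (12 ^+ l' * (5 * tau)) ^+ 2)) =
    12 ^+ (2 * l) * (256 * 25 ^+ 2 * (25 ^+ m / (12 ^+ m * 12 ^+ J)) + 100 * tau ^+ 2) :> R.
  rewrite lE; clearbody tau J l' m; rewrite mulnDr exprD ![(2 * _)%N]mulnC !exprM.
  have := gt_eqF (Q0 m); have := gt_eqF (Q0 J).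
  set X := 12 ^+ m; set Y := 12 ^+ J; set Z := 12 ^+ l'; set W := 25 ^+ m => Y0 X0.
  by field; rewrite X0 Y0.
rewrite -[X in _ <= X]mulrA ler_pM2l//.
have -> : 25 ^+ m / (12 ^+ m * 12 ^+ J) = (25 ^+ 13 / 12 ^+ 23) ^+ n :> R.
  rewrite exprMn exprVn -!exprM -exprD /m /J; congr (_ / _ ^+ _); lia.
have t2 : tau ^+ 2 <= 25 ^+ 46 * (25 ^+ 6)^-1 ^+ n.
  have -> : (25 ^+ 6)^-1 ^+ n = (25 ^+ (3 * n))^-1 ^+ 2 :> R.
    by rewrite !exprVn -!exprM; congr (_ ^+ _)^-1; lia.
  have -> : 25 ^+ 46 * (25 ^+ (3 * n))^-1 ^+ 2 = (25 ^+ 23 / 25 ^+ (3 * n)) ^+ 2 :> R.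
    by rewrite exprMn -exprM.
  apply: lerXn2r; rewrite ?nnegrE ?(ltW tau0) ?divr_ge0 ?(ltW (P0 _))//.
  apply: (le_trans tau3); rewrite ler_pM2r ?invr_gt0//.
  by have := P0 23%N; set X := 25 ^+ 23; lra.
set u := _ ^+ n; set v := _ ^+ n in t2 *.
have u0 : 0 <= u by rewrite exprn_ge0// divr_ge0// ltW.
have v0 : 0 <= v by rewrite exprn_ge0// invr_ge0 ltW.
have e48 : 25 ^+ 48 = 25 ^+ 2 * 25 ^+ 46 :> R by rewrite -exprD.
have e46 : 256 <= 25 ^+ 46 :> R by lra.
rewrite e48; set X := 25 ^+ 46 in t2 e46 *; have -> : 25 ^+ 2 = 625 :> R by ring.
by nra.
Qed.

(** The pointwise decay over E_1 is taken out of the sum, and the large sieve over F_1 bounds the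
    rest. The resulting ratios [25 ^ 36 / (12 ^ 23 * 23 ^ 19)] and [25 ^ 17 / 23 ^ 19] are at most
    1/2. *)
Lemma energy_EF_block : exists2 D : R, 0 < D & forall n l, (8 <= n)%N -> (23 * n <= l)%N ->
  \sum_(25 ^ (23 * n) <= k < 25 ^ (23 * n.+1))
     exp_sum_sq (PE l) (fun x => k%:R * tE x) * exp_sum_sq (PF l) (fun y => k%:R * tF y) <=
  12 ^+ (2 * l) * 23 ^+ (2 * l) * (D * (1 / 2) ^+ n).
Proof.
have [C C0 decay] := decay_E.
pose D : R := C * (64 * 49 ^+ 2 * 25 ^+ 23) * 2.
have pos (x : R) j : 0 < x -> 0 < x ^+ j by move=> x0; rewrite exprn_gt0.
have D0 : 0 < D by rewrite !mulr_gt0// pos.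
exists D => // n l n8 nl.
set w : R := (25 ^+ 13 / 12 ^+ 23) ^+ n + (25 ^+ 6)^-1 ^+ n.
have w0 : 0 <= w.
  by rewrite addr_ge0// exprn_ge0// ?invr_ge0 ?exprn_ge0// divr_ge0 ?exprn_ge0.
have lt_pow : (0 < 25 ^ (23 * n.+1))%N by rewrite expn_gt0.
have Jl : (19 * n <= l)%N by lia.
(* Since [49 ^ 19 <= 25 ^ 23], the large sieve over F_1 may use [J = 19 * n]. *)
have NJ : 49 ^+ (19 * n) <= (25 ^ (23 * n.+1))%:R :> R.
  rewrite natrX mulnS exprD !exprM; apply: (@le_trans _ _ ((25 ^+ 23) ^+ n)).
    by apply: lerXn2r; rewrite ?nnegrE ?exprn_ge0//; lra.
  by rewrite ler_peMl ?exprn_ge0// exprn_ege1//; lra.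
have := mean_square_F Jl lt_pow NJ; set S := \sum_(_ <= _ < _) _ => SF.
have P0 : 0 <= 12 ^+ (2 * l) * C * w by rewrite !mulr_ge0// ?exprn_ge0// ltW.
apply: (@le_trans _ _ (12 ^+ (2 * l) * C * w * S)).
  rewrite /S [X in _ <= _ * X](@big_cat_nat _ _ _ (25 ^ (23 * n)))//=; last first.
    by rewrite leq_exp2l// leq_mul2l leqnSn orbT.
  rewrite mulrDr ler_wpDl//.
    by rewrite mulr_ge0// sumr_ge0// => k _; exact: exp_sum_sq_ge0.
  rewrite big_distrr/= [X in X <= _]big_nat [X in _ <= X]big_nat; apply: ler_sum => k /andP[k1 k2].
  rewrite ler_wpM2r ?exp_sum_sq_ge0//; apply: decay => //.
    by rewrite -natrX ler_nat.
  by rewrite -natrX ler_nat ltnW.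
apply: (le_trans (ler_wpM2l P0 SF)).
have -> : 12 ^+ (2 * l) * C * w * (64 * 49 ^+ 2 * (25 ^ (23 * n.+1))%:R * 23 ^+ (2 * l) / 23 ^+ (19 * n)) =
    12 ^+ (2 * l) * 23 ^+ (2 * l) * (C * (64 * 49 ^+ 2 * 25 ^+ 23) *
      (w * ((25 ^+ 23) ^+ n / 23 ^+ (19 * n)))).
  rewrite natrX mulnS exprD [25 ^+ (23 * n)]exprM.
  have : 23 ^+ (19 * n) != 0 :> R by rewrite gt_eqF// pos.
  set a := 23 ^+ (19 * n); set b := 25 ^+ 23 => a0.
  by field.
rewrite ler_pM2l; last by rewrite mulr_gt0 ?pos.
rewrite /D -[X in _ <= X]mulrA ler_pM2l; last by rewrite !mulr_gt0 ?pos.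
have half (x : R) : 0 <= x -> x * 2 <= 1 -> x ^+ n <= (1 / 2) ^+ n.
  by move=> x0 x2; apply: lerXn2r; rewrite ?nnegrE//; lra.
have -> : (25 ^+ 23) ^+ n / 23 ^+ (19 * n) = (25 ^+ 23 / 23 ^+ 19) ^+ n :> R.
  by rewrite [RHS]exprMn exprVn -[(23 ^+ 19) ^+ n]exprM.
rewrite /w mulrDl -!exprMn.
have h1 : (25 ^+ 13 / 12 ^+ 23 * (25 ^+ 23 / 23 ^+ 19)) ^+ n <= (1 / 2 : R) ^+ n.
  apply: half; first by rewrite !mulr_ge0 ?invr_ge0 ?exprn_ge0.
  have -> : 25 ^+ 13 / 12 ^+ 23 * (25 ^+ 23 / 23 ^+ 19) * 2 = (2 * 25 ^+ 36) / (12 ^+ 23 * 23 ^+ 19) :> R.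
    have -> : 25 ^+ 36 = 25 ^+ 13 * 25 ^+ 23 :> R by rewrite -exprD.
    have : 12 ^+ 23 != 0 :> R by rewrite gt_eqF// pos.
    have : 23 ^+ 19 != 0 :> R by rewrite gt_eqF// pos.
    set a := 12 ^+ 23; set b := 23 ^+ 19; set c := 25 ^+ 13; set d := 25 ^+ 23 => b0 a0.
    by field; rewrite a0 b0.
  rewrite ler_pdivrMr ?mul1r; last by rewrite mulr_gt0 ?pos.
  lra.
have h2 : ((25 ^+ 6)^-1 * (25 ^+ 23 / 23 ^+ 19)) ^+ n <= (1 / 2 : R) ^+ n.
  apply: half; first by rewrite !mulr_ge0 ?invr_ge0 ?exprn_ge0.
  have -> : (25 ^+ 6)^-1 * (25 ^+ 23 / 23 ^+ 19) * 2 = (2 * 25 ^+ 23) / (25 ^+ 6 * 23 ^+ 19) :> R.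
    have : 25 ^+ 6 != 0 :> R by rewrite gt_eqF// pos.
    have : 23 ^+ 19 != 0 :> R by rewrite gt_eqF// pos.
    set a := 25 ^+ 6; set b := 23 ^+ 19; set d := 25 ^+ 23 => b0 a0.
    by field; rewrite a0 b0.
  rewrite ler_pdivrMr ?mul1r; last by rewrite mulr_gt0 ?pos.
  lra.
by set u := (1 / 2) ^+ n in h1 h2 *; lra.
Qed.

(** Frequencies below [25 ^ (23 * 8)] are estimated trivially; the later blocks form a convergent
    geometric series. *)
Lemma energy_EF : exists2 C : R, 0 < C & forall m l, (23 * m <= l)%N ->
  \sum_(0 <= k < 25 ^ (23 * m))
     exp_sum_sq (PE l) (fun x => k%:R * tE x) * exp_sum_sq (PF l) (fun y => k%:R * tF y) <=
  12 ^+ (2 * l) * 23 ^+ (2 * l) * C.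
Proof.
have [D D0 block] := energy_EF_block.
have [T TE] : exists T : nat, T = (25 ^ (23 * 8))%N by exists (25 ^ (23 * 8))%N.
have T0 : 0 <= T%:R :> R by [].
exists (T%:R + 1 + 2 * D) => [|m l ml]; first by lra.
have W0 : 0 < 12 ^+ (2 * l) * 23 ^+ (2 * l) :> R by rewrite mulr_gt0 ?exprn_gt0.
pose f k : R := exp_sum_sq (PE l) (fun x => k%:R * tE x) * exp_sum_sq (PF l) (fun y => k%:R * tF y).
have fle k : f k <= 12 ^+ (2 * l) * 23 ^+ (2 * l).
  rewrite /f; apply: ler_pM; rewrite ?exp_sum_sq_ge0//.
    by apply: (le_trans (exp_sum_sq_le _ _)); rewrite size_prefixes natrX -exprM [X in _ ^+ X <= _]mulnC.
  by apply: (le_trans (exp_sum_sq_le _ _)); rewrite size_prefixes natrX -exprM [X in _ ^+ X <= _]mulnC.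
(* Sharpened to partial sums of the geometric series so that the induction closes. *)
suff : \sum_(0 <= k < 25 ^ (23 * m)) f k <=
    12 ^+ (2 * l) * 23 ^+ (2 * l) * (T%:R + 2 * D * (1 - (1 / 2) ^+ m)).
  move=> /le_trans; apply; rewrite ler_pM2l//.
  have : 0 <= (1 / 2 : R) ^+ m by rewrite exprn_ge0.
  set u := _ ^+ m => u0; nra.
have small j : (j <= 8)%N -> \sum_(0 <= k < 25 ^ (23 * j)) f k <=
    12 ^+ (2 * l) * 23 ^+ (2 * l) * (T%:R + 2 * D * (1 - (1 / 2) ^+ j)).
  move=> j8; apply: (@le_trans _ _ (\sum_(0 <= k < 25 ^ (23 * j)) 12 ^+ (2 * l) * 23 ^+ (2 * l))).
    by apply: ler_sum => k _; exact: fle.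
  rewrite sumr_const_nat subn0 -[X in X <= _]mulr_natr ler_pM2l//.
  have h1 : (25 ^ (23 * j))%:R <= T%:R :> R.
    by rewrite ler_nat TE leq_exp2l// leq_mul2l j8 orbT.
  have h2 : 0 <= 1 - (1 / 2 : R) ^+ j by rewrite subr_ge0 exprn_ile1//; lra.
  by apply: (le_trans h1); rewrite lerDl mulr_ge0// ltW// mulr_gt0.
clear TE; elim: m ml => [|m IH] ml; first exact: small.
have [m8|m8] := leqP m.+1 8; first exact: small.
have le_pow : (25 ^ (23 * m) <= 25 ^ (23 * m.+1))%N by rewrite leq_exp2l// leq_mul2l leqnSn orbT.
rewrite (@big_cat_nat _ _ _ (25 ^ (23 * m)))//=.
apply: (le_trans (lerD (IH _) (block m l _ _))); [by lia|by lia|by lia|].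
rewrite -mulrDr ler_pM2l// exprS; set u := _ ^+ m; lra.
Qed.

(** Cauchy-Schwarz for the occupation numbers of the cells, whose squares count coincident pairs. *)
Lemma size_sqr_le_cells (T : eqType) (s : seq T) (c : T -> nat) :
  (size s)%:R ^+ 2 <= (size (undup (map c s)))%:R *
     \sum_(z <- s) \sum_(z' <- s) (c z == c z')%:R :> R.
Proof.
set u := undup _.
have uE (a : T) : a \in s -> \sum_(i <- u) (c a == i)%:R = 1 :> R.
  move=> sa; have ca : c a \in u by rewrite mem_undup map_f.
  rewrite (bigD1_seq (c a))//= ?undup_uniq// eqxx big1 ?addr0// => i ic.
  by rewrite eq_sym (negbTE ic).
have sizeE : (size s)%:R = \sum_(i <- u) \sum_(a <- s) (c a == i)%:R :> R.
  rewrite exchange_big/= big_seq (eq_bigr (fun _ => 1)) -?big_seq.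
    by rewrite sum_const_seq mulr1.
  by move=> a /uE.
rewrite sizeE; apply: (le_trans (sum_sqr_le _ _)); rewrite ler_wpM2l//.
under eq_bigr do rewrite expr2 big_distrlr/=.
rewrite exchange_big/= big_seq [X in _ <= X]big_seq; apply: ler_sum => a sa.
rewrite exchange_big/=; apply: ler_sum => b _.
have [cab|cab] := eqVneq (c a) (c b).
  apply: (@le_trans _ _ (\sum_(i <- u) (c a == i)%:R)); last by rewrite uE.
  by apply: ler_sum => i _; rewrite -cab; case: eqP => _; rewrite ?mulr1 ?mulr0.
rewrite big1// => i _; case: eqP => [<-|_]; last by rewrite mul0r.
by rewrite eq_sym (negbTE cab) mulr0.
Qed.

(** Quotients in a common cell have logarithms so close that the Fejer kernel of order [K] is at
    least [K ^ 2 / 4]. Its sum over all pairs is bounded by the energy, so coincidences are few and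
    many cells are occupied. *)
Lemma division_set_many_cells : exists2 c : R, 0 < c & forall m, exists s : seq nat,
  [/\ uniq s, c * 25 ^+ (23 * m) <= (size s)%:R & forall i, i \in s ->
   exists2 v, division_set (block_set R 1 2) (block_set R 13 1) v &
     i%:R <= 12 * 25 ^+ (23 * m) * v < i.+1%:R].
Proof.
have [C C0 energy] := energy_EF.
exists (8 * C)^-1; first by rewrite invr_gt0 mulr_gt0.
move=> m; pose l := (23 * m)%N; pose K : nat := (25 ^ (23 * m))%N.
have K0 : 0 < K%:R :> R by rewrite ltr0n expn_gt0.
pose a (x : nat) : R := (x%:R + 1) / 25 ^+ l.
pose b (y : nat) : R := (y%:R + 1 / 2) / 49 ^+ l.
pose v (z : nat * nat) : R := b z.2 / a z.1.
pose s := [seq (x, y) | x <- PE l, y <- PF l].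
have aK (x : nat) : x \in PE l -> block_set R 13 1 (a x) by exact: prefix_point_E.
have bK (y : nat) : y \in PF l -> block_set R 1 2 (b y) by exact: prefix_point_F.
have sP (z : nat * nat) : z \in s -> z.1 \in PE l /\ z.2 \in PF l by case/allpairsP => -[x y] /= [? ? ->].
have vlb (z : nat * nat) : z \in s -> 1 / 24 <= v z.
  case/sP => /aK/(block_set_bound (isT : 0 < 1)%N)/andP[a1 a2] /bK/(block_set_bound (isT : 0 < 2)%N)/andP[b1 b2].
  by rewrite /v ler_pdivlMr; lra.
(* Cells have length [1 / (12 * K)]; as quotients are at least 1/24, half-logarithms within a cell
   differ by at most [1 / K]. *)
pose c (z : nat * nat) : nat := Num.truncn (12 * K%:R * v z).
have c1 (z : nat * nat) : z \in s -> (c z)%:R <= 12 * K%:R * v z < (c z).+1%:R.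
  move=> zs; apply: truncn_itv; apply: mulr_ge0; first exact: mulr_ge0.
  by apply: le_trans (vlb z zs); lra.
exists (undup (map c s)); split; first exact: undup_uniq; last first.
  move=> i; rewrite mem_undup => /mapP[z zs ->]; exists (v z).
    by have [z1 z2] := sP z zs; exists (b z.2); [exact: bK|exists (a z.1) => //; exact: aK].
  by have := c1 z zs; rewrite natrX.
(* Half the logarithm of the quotient, up to a constant that cancels in differences. *)
pose phi (z : nat * nat) : R := - tE z.1 + tF z.2.
have phiE (z : nat * nat) : z \in s -> phi z = ln (v z) / 2 + (ln (49 ^+ l) - ln (25 ^+ l)) / 2.
  move=> zs; rewrite /phi /tE /tF /v /a /b.
  have p1 : 0 < z.1%:R + 1 :> R by have := ler0n R z.1; lra.
  have p2 : 0 < z.2%:R + 1 / 2 :> R by have := ler0n R z.2; lra.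
  have p3 : 0 < 25 ^+ l :> R by rewrite exprn_gt0.
  have p4 : 0 < 49 ^+ l :> R by rewrite exprn_gt0.
  rewrite ln_div ?posrE ?divr_gt0// !ln_div ?posrE//; lra.
have coincidence (z z' : nat * nat) : z \in s -> z' \in s -> (c z == c z')%:R * (K%:R ^+ 2 / 4) <=
    fejer K (phi z - phi z').
  move=> zs zs'; case: eqP => cz; last by rewrite mul0r exp_sum_sq_ge0.
  rewrite mul1r; apply: fejer_ge.
  rewrite !phiE// opprD addrACA subrr addr0 -mulrBl normrM [`|2^-1|]ger0_norm//.
  have c24 : 0 < 1 / 24 :> R by [].
  have := ln_dist_le c24 (vlb z zs) (vlb z' zs').
  have : K%:R * `|v z - v z'| <= 1 / 12.
    have /andP[h1 h2] := c1 z zs; have /andP[h3 h4] := c1 z' zs'.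
    rewrite -cz -natr1 in h3 h4; rewrite -natr1 in h2.
    rewrite -{1}(gtr0_norm K0) -normrM ler_norml; apply/andP; split; lra.
  rewrite ler_pdivlMr// => h1 h2; have := ler_wpM2l (ltW K0) h2; lra.
have := size_sqr_le_cells s c; set Z := size (undup _); set Q := \sum_(_ <- _) _ => sq.
have sizeE : (size s)%:R = 12 ^+ l * 23 ^+ l :> R.
  by rewrite size_allpairs !size_prefixes natrM !natrX.
have Q1 : Q * (K%:R ^+ 2 / 4) <= 2 * K%:R * ((size s)%:R ^+ 2 * C).
  rewrite /Q big_distrl/=.
  apply: (@le_trans _ _ (\sum_(z <- s) \sum_(z' <- s) fejer K (phi z - phi z'))).
    rewrite big_seq [X in _ <= X]big_seq; apply: ler_sum => z zs.
    rewrite big_distrl/= big_seq [X in _ <= X]big_seq; apply: ler_sum => z' zs'.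
    exact: coincidence.
  apply: (le_trans (sum_fejer_le _ _ _)); rewrite ler_pM2l ?mulr_gt0//.
  rewrite sizeE exprMn -!exprM ![(l * 2)%N]mulnC.
  apply: le_trans (energy m l (leqnn _)); apply: ler_sum => k _.
  (* Conjugation absorbs the sign of the phase over E_1, and the sum over pairs factors. *)
  rewrite -(exp_sum_sq_opp (PE l)) -exp_sum_sq_prod le_eqVlt; apply/orP; left; apply/eqP.
  by congr (exp_sum_sq _ _); apply/funext => z; rewrite /phi mulrDr mulrN.
have s0 : 0 < (size s)%:R ^+ 2 :> R by rewrite exprn_gt0// sizeE mulr_gt0 ?exprn_gt0.
rewrite -natrX -/K ler_pdivrMl ?mulr_gt0//.
have Q2 : Q * K%:R <= 8 * (size s)%:R ^+ 2 * C.
  rewrite -(ler_pM2r K0); move: Q1; rewrite expr2; lra.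
rewrite -(ler_pM2r s0).
have := ler_wpM2r (ltW K0) sq; have := ler_wpM2l (ler0n R Z) Q2.
lra.
Qed.

End energy.

(** * Positive measure *)

Section measure.
Context (R : realType).

Lemma cells_measure (s : seq nat) (K : R) : 0 < K -> uniq s ->
  let cell (i : nat) := `[i%:R / K, i.+1%:R / K[%classic : set R in
  measurable (\bigcup_(i in [set` s]) cell i) /\
  lebesgue_measure (\bigcup_(i in [set` s]) cell i) = ((size s)%:R / K)%:E.
Proof.
move=> K0 us cell.
have fs : finite_set [set` s] by exact: finite_seq.
have mc i : measurable (cell i) by exact: measurable_itv.
have muc i : lebesgue_measure (cell i) = (K^-1)%:E.
  rewrite lebesgue_measure_itv/= lte_fin ltr_pM2r ?invr_gt0// ltr_nat ltnSn.
  by rewrite -EFinB -mulrBl -natr1 addrAC subrr add0r mul1r.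
split; first by apply: fin_bigcup_measurable.
rewrite measure_fin_bigcup; [|exact: fs| |by move=> i _; exact: mc]; last first.
  apply/trivIsetP => i j _ _ ij; apply/seteqP; split=> // x [] /=.
  rewrite /cell /= !in_itv/= !ler_pdivrMr// !ltr_pdivlMr// => /andP[h1 h2] /andP[h3 h4].
  move: ij; rewrite neq_ltn => /orP[ij|ij].
  - have := le_lt_trans h3 h2; rewrite ltr_nat ltnS; lia.
  - have := le_lt_trans h1 h4; rewrite ltr_nat ltnS; lia.
rewrite -fsbig_seq// (eq_bigr (fun _ => (K^-1)%:E)) => [|i _]; last exact: muc.
by rewrite sumEFin sum_const_seq.
Qed.

(** If [V] were null, it would have an open neighbourhood [U] of measure below [c], containing by
    compactness a uniform [e]-neighbourhood of [V]. Cells shorter than [e] that meet [V] lie in [U],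
    yet have total length at least [c]. *)
Lemma compact_many_cells_measure (V : set R) (c : R) : compact V -> 0 < c ->
  (forall M : R, exists2 K : R, M <= K & exists s : seq nat,
     [/\ uniq s, c * K <= (size s)%:R & forall i, i \in s ->
        exists2 v, V v & i%:R <= K * v < i.+1%:R]) ->
  (0 < lebesgue_measure V)%E.
Proof.
move=> cV c0 cells; rewrite lt_neqAle measure_ge0 andbT eq_sym; apply/negP => /eqP.
pose mu : {measure set (measurableTypeR R) -> \bar R} := @lebesgue_measure R.
rewrite -[lebesgue_measure V]/(mu V) => V0.
have mV : measurable V by exact: measurable_realfun.compact_measurable.
have [||U [oU VU UV]] := @lebesgue_regularity_outer R V c mV.
- by rewrite -[X in (X < _)%E]/(mu V) V0.
- by [].
rewrite -[X in (X < _)%E]/(mu _) in UV.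
have Uc : (mu U < c%:E)%E.
  have mU : measurable U by exact: measurable_realfun.open_measurable.
  apply: le_lt_trans UV; rewrite -[leRHS]adde0 -V0 -measureU//; last 2 first.
  - exact: measurableD.
  - by apply/seteqP; split=> // x [[_ nV] /nV].
  by rewrite setUC setDUK.
have unif : \forall e \near 0^'+, V `<=` [set v | ball v e `<=` U].
  have /compact_near_coveringP := cV; apply => v /VU Uv.
  have /nbhs_ballP[r /= r0 rU] : nbhs v U by exact: open_nbhs_nbhs.
  exists (ball v (r / 2), [set e | 0 < e < r / 2]) => /=.
    split; first by apply: nbhsx_ballx; rewrite divr_gt0.
    near=> e; apply/andP; split; first by near: e; exact: nbhs_right_gt.
    by near: e; apply: nbhs_right_lt; rewrite divr_gt0.
  move=> [w e] /= [vw /andP[e0 er]] x wx; apply: rU.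
  by rewrite [r]splitr; apply: ball_triangle vw _; exact: le_ball (ltW er) _ wx.
have /filter_ex[e [e0 VeU]] : \forall e \near 0^'+, 0 < e /\ V `<=` [set v | ball v e `<=` U].
  by apply: filterS2 (nbhs_right_gt 0) unif => e.
have [K eK [s [us sK sV]]] := cells (e^-1 + 1).
have K0 : 0 < K by apply: lt_le_trans eK; rewrite ltr_wpDl// invr_ge0 ltW.
have Ke : K^-1 < e.
  by rewrite invf_plt ?posrE//; apply: lt_le_trans eK; rewrite ltrDl.
have [mC CE] := cells_measure K0 us; set C := \bigcup_(i in _) _ in mC CE.
have CU : C `<=` U.
  move=> x [i /= si]; rewrite /= in_itv/= ler_pdivrMr// ltr_pdivlMr// => /andP[x1 x2].
  have [v Vv /andP[v1 v2]] := sV i si; apply: (VeU v Vv).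
  apply: lt_trans Ke.
  rewrite -(ltr_pM2l K0) mulfV ?gt_eqF// -{1}(gtr0_norm K0) -normrM.
  by move: x2 v2; rewrite -natr1 ltr_norml => x2 v2; apply/andP; split; lra.
have : (mu C <= mu U)%E.
  by apply: le_measure; rewrite ?inE//; exact: measurable_realfun.open_measurable.
rewrite [mu C]CE => /le_lt_trans/(_ Uc); rewrite lte_fin ltr_pdivrMr// => h.
by have := lt_le_trans h sK; rewrite ltxx.
Unshelve. all: by end_near. Qed.

End measure.

(** * Change of base and application to E_r and F_s *)

Section conclusion.
Context (R : realType).
Implicit Types (p q n r s t : nat).

(** A group of [n] digits becomes a single digit in the [n]-th power of the base. *)
Lemma block_set_sub_power p q t n : (0 < q)%N -> (0 < t)%N -> (p <= 13)%N ->
  (24 * t + 1 = (24 * q + 1) ^ n)%N -> block_set R p q `<=` block_set R p t.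
Proof.
move=> q0 t0 p13 tE; apply: block_set_coind => // x Kx.
have NE : (24 * t + 1)%:R = (24 * q + 1)%:R ^+ n :> R by rewrite tE natrX.
have Nt : (24 * t + 1)%:R = 24 * t%:R + 1 :> R by rewrite natrD natrM.
have N0 : 0 < (24 * t + 1)%:R :> R by rewrite ltr0n addn1.
have hull z : block_set R p q z -> 0 <= z <= 1.
  move=> /(block_set_bound q0)/andP[h1 h2]; apply/andP; split.
    by apply: le_trans h1; rewrite divr_ge0.
  by apply: (le_trans h2); rewrite ler_pdivrMr// mul1r ler_nat; lia.
split; first exact: hull.
have [k [e [Ke -> ext]]] := block_set_prefix n q0 p13 Kx.
exists k; last by rewrite -NE mulrC divfK ?gt_eqF// addrC addKr.
(* Splicing in the two extreme tails and comparing with the hull bounds the prefix [k] as an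
   admissible digit. *)
have := ext _ (@block_set_const R p q p q0 p13 ltac:(by rewrite leqnn leq_addr)).
have := ext _ (@block_set_const R p q (p + 11) q0 p13 ltac:(by rewrite leqnn leq_addr)).
rewrite -NE => /(block_set_bound q0)/andP[_ h1] /(block_set_bound q0)/andP[h2 _].
rewrite ler_pdivrMr// in h1; rewrite ler_pdivlMr// in h2.
rewrite -!(ler_nat R) !natrM; move: h1 h2; rewrite Nt.
by move=> h1 h2; apply/andP; split; lra.
Qed.

Lemma baseAE r : (24 * stepq r + 1 = 25 ^ r)%N.
Proof.
rewrite /stepq /baseA mulnC divnK ?subnK ?expn_gt0//.
by rewrite -eqn_mod_dvd ?expn_gt0// -modnXm exp1n.
Qed.

Lemma baseBE s : (24 * stept s + 1 = 49 ^ s)%N.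
Proof.
rewrite /stept /baseB mulnC divnK ?subnK ?expn_gt0//.
by rewrite -eqn_mod_dvd ?expn_gt0// -modnXm exp1n.
Qed.

Lemma stepq_gt0 r : (0 < r)%N -> (0 < stepq r)%N.
Proof.
move=> r0; have := baseAE r; have : (25 ^ 1 <= 25 ^ r)%N by rewrite leq_exp2l.
by rewrite expn1; lia.
Qed.

(** With [p = 1] the product criterion requires [12 <= 11 * t], so positivity would not suffice. *)
Lemma stept_gt1 s : (0 < s)%N -> (1 < stept s)%N.
Proof.
move=> s0; have := baseBE s; have : (49 ^ 1 <= 49 ^ s)%N by rewrite leq_exp2l.
by rewrite expn1; lia.
Qed.

Lemma setEE r : setE R r = block_set R 13 (stepq r).
Proof. by rewrite /setE /block_set baseAE. Qed.

Lemma setFE s : setF R s = block_set R 1 (stept s).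
Proof. by rewrite /setF /block_set baseBE mul1n. Qed.

(** By inclusion it suffices to treat E_1 and F_1, of whose bases the others are powers. *)
Lemma division_set_block_measure q t m n : (0 < q)%N -> (0 < t)%N ->
  (24 * q + 1 = 25 ^ m)%N -> (24 * t + 1 = 49 ^ n)%N ->
  (0 < lebesgue_measure (division_set (block_set R 1 t) (block_set R 13 q)))%E.
Proof.
move=> q0 t0 qE tE.
have pos j : block_set R 13 j `<=` [set x | 0 < x] \/ j = 0%N.
  case: j => [|j]; [by right|left] => x /(block_set_bound (ltn0Sn _))/andP[h _].
  by apply: lt_le_trans h; rewrite divr_gt0.
have cpt i j : (0 < i)%N -> (0 < j)%N ->
    compact (division_set (block_set R 1 j) (block_set R 13 i)).
  move=> i0 j0; have [Ep|i00] := pos i; last by rewrite i00 in i0.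
  by apply: division_set_compact => //; exact: block_set_compact.
apply: (@lt_le_trans _ _ (lebesgue_measure (division_set (block_set R 1 2) (block_set R 13 1)))).
  have [c c0 cells] := division_set_many_cells R.
  apply: (@compact_many_cells_measure _ _ (c / 12)); [exact: cpt|by rewrite divr_gt0|].
  move=> M; pose j := (Num.truncn M).+1.
  have [u [us uc uV]] := cells j; exists (12 * 25 ^+ (23 * j)).
    apply: (le_trans (ltW (truncnS_gt M))); rewrite -/j.
    apply: (@le_trans _ _ (25 ^+ (23 * j))); last first.
      by have : 0 <= 25 ^+ (23 * j) :> R by []; lra.
    rewrite -natrX ler_nat; apply: ltnW; apply: (@leq_trans (25 ^ j)).
      exact: ltn_expl.
    by rewrite leq_exp2l//; lia.
  exists u; split=> //; apply: le_trans uc.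
  by set X := 25 ^+ _; rewrite le_eqVlt; apply/orP; left; apply/eqP; field.
apply: le_measure; rewrite ?inE.
- by apply: measurable_realfun.compact_measurable; exact: cpt.
- by apply: measurable_realfun.compact_measurable; exact: cpt.
move=> _ [y Fy [x Ex <-]]; exists y; first exact: (@block_set_sub_power 1 2 t n isT t0 isT tE).
by exists x => //; exact: (@block_set_sub_power 13 1 q m isT q0 isT qE).
Qed.

End conclusion.

Unset Implicit Arguments.

Theorem theorem1p3 (R : realType) :
  (forall r s : nat, (0 < r)%N -> (0 < s)%N ->
     [/\ compact (division_set (setF R s) (setE R r)),
         perfect_set (division_set (setF R s) (setE R r)),
         nowhere_dense (division_set (setF R s) (setE R r)) &
         (0 < lebesgue_measure (division_set (setF R s) (setE R r)))%E])
  /\ (hausdorff_dim (setE R r) @[r --> \oo] --> 1%E)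
  /\ (hausdorff_dim (setF R s) @[s --> \oo] --> 1%E)
  /\ (exists n0 : nat, forall r s : nat, (n0 <= r)%N -> (n0 <= s)%N ->
       contains_interval (product_set (setE R r) (setE R r)) /\
       contains_interval (product_set (setF R s) (setF R s)))
  /\ contains_interval (product_set (setE R 6) (setE R 6))
  /\ contains_interval (product_set (setF R 5) (setF R 5)).
Proof.
(* Every positive index works, so the threshold is 1 and the cases 6 and 5 are instances. *)
have prodE r : (0 < r)%N -> contains_interval (product_set (setE R r) (setE R r)).
  move=> /stepq_gt0 q0; rewrite setEE; apply: block_set_product_interval => //; lia.
have prodF s : (0 < s)%N -> contains_interval (product_set (setF R s) (setF R s)).
  move=> /stept_gt1 t1; rewrite setFE; apply: block_set_product_interval => //; lia.
split; last split; last split; last split; last split.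
- move=> r s /[dup] r0 /stepq_gt0 q0 /[dup] s0 /stept_gt1/ltnW t0; rewrite setEE setFE.
  have Epos : block_set R 13 (stepq r) `<=` [set x | 0 < x].
    by move=> x /(block_set_bound q0)/andP[h _]; apply: lt_le_trans h; rewrite divr_gt0.
  have cE : compact (block_set R 13 (stepq r)) by exact: block_set_compact.
  have cF : compact (block_set R 1 (stept s)) by exact: block_set_compact.
  split.
  + exact: division_set_compact.
  + by apply: division_set_perfect => // y e; exact: block_set_dense_in_itself.
  + apply: division_set_nowhere_dense => //.
    by rewrite baseAE baseBE coprimeXl// coprimeXr.
  + exact: division_set_block_measure (baseAE r) (baseBE s).
- under eq_fun do rewrite setEE.
  by apply: (@hausdorff_dim_block_set_cvg R 13 25) => // r; exact: baseAE.
- under eq_fun do rewrite setFE.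
  by apply: (@hausdorff_dim_block_set_cvg R 1 49) => // s; exact: baseBE.
- by exists 1%N => r s r1 s1; split; [exact: prodE|exact: prodF].
- exact: prodE.
- exact: prodF.
Qed.
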